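(* Consider the $(r,q)$ continuous review lost sales inventory system with Poisson unit demand of rate $\lambda$ and constant lead time $\tau$, and let $x=\lambda\tau$. Let $\gamma$ be its long run fraction of time with no on hand inventory, $L$ its long run average on hand inventory, $U$ its long run average number of units in outstanding replenishment orders, and $P$ its long run average inventory position. The relationships between $\gamma$, $L$, $P$ and $U$ are given by: a) $P = (1-\gamma)\left(r+\tfrac12(q+1)\right)+\gamma\, q\left\lfloor \frac{r+q}{q}\right\rfloor$; b) $L = P-U$; c) $U=(1-\gamma)x$; d) $L=(1-\gamma)\left(r+\tfrac12(q+1)-x\right)+\gamma\, q\left\lfloor \frac{r+q}{q}\right\rfloor$. Any one of $\gamma$, $L$, $P$, or $U$ determines all of the others.
   Context: The $(r,q)$ lost sales system (with integers $r\ge 0$, $q\ge 1$, and reals $\lambda>0$, $\tau>0$) is the following continuous-time stochastic inventory system. Customers arrive according to a Poisson process of rate $\lambda$, each demanding one unit. Let $l(t)\ge 0$ be the on hand inventory at epoch $t$, $u(t)$ the total number of units in outstanding replenishment orders (placed but not yet delivered), and $p(t)=l(t)+u(t)$ the inventory position. If a customer arrives when on hand inventory is positive, the demand is served immediately and on hand inventory decreases by one; if a customer arrives when on hand inventory is zero, the demand is lost (a lost sale) and the state does not change. Inventory is continuously reviewed: whenever serving a demand makes the inventory position drop to $r$, a replenishment order of $q$ units is placed immediately (so after ordering the inventory position lies in $\{r+1,\dots,r+q\}$). Each order is delivered exactly $\tau$ time units after it is placed, increasing on hand inventory by $q$. Several orders may be simultaneously outstanding. The quantities $\gamma$, $L$,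 $U$, $P$ are long run time averages of, respectively, the indicator that $l(t)=0$, and of $l(t)$, $u(t)$, $p(t)$. The quantity $x=\lambda\tau$ is the mean lead time demand. *)

(* Defs.v *)
From HB Require Import structures.
From mathcomp Require Import all_boot all_order all_algebra finmap.
From mathcomp Require Import all_classical all_reals all_analysis.
Set Implicit Arguments.
Unset Strict Implicit.
Unset Printing Implicit Defensive.
Import Order.TTheory GRing.Theory Num.Theory.
Import numFieldNormedType.Exports.
Local Open Scope classical_set_scope.
Local Open Scope ring_scope.

Definition mutually_independent (R : realType) (d : measure_display)
    (Omega : measurableType d) (Pr : probability Omega R)
    (X : nat -> Omega -> R) : Prop :=
  forall (J : {fset nat}) (B : nat -> set R),
    (forall i, measurable (B i)) ->
    Pr (\bigcap_(i in [set` J]) (X i @^-1` B i)) =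
    (\prod_(i <- J) Pr (X i @^-1` B i))%E.

(* The arrival epochs of a Poisson process of rate [lam] are the partial sums
   of independent exponential interarrival times. *)
Definition poisson_interarrivals (R : realType) (d : measure_display)
    (Omega : measurableType d) (Pr : probability Omega R) (lam : R)
    (X : nat -> {RV Pr >-> R}) : Prop :=
  mutually_independent Pr X /\
  forall n (B : set R), measurable B ->
    distribution Pr (X n) B = exponential_prob lam B.

Section Dynamics.
Variable R : realType.
Variables (r q : nat) (tau : R).

(* [due] lists the delivery epochs of the outstanding orders, each of [q]
   units. *)
Record state := State { on_hand : nat; due : seq R }.

Definition on_order (s : state) : nat := (q * size (due s))%N.
Definition position (s : state) : nat := (on_hand s + on_order s)%N.

Definition deliver (t : R) (s : state) : state :=
  State (on_hand s + q * count (fun e => e <= t) (due s))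
        [seq e <- due s | t < e].

Definition replenish (t : R) (s : state) : state :=
  if position s == r then State (on_hand s) (rcons (due s) (t + tau)) else s.

Definition demand (t : R) (s : state) : state :=
  if on_hand s is l.+1 then replenish t (State l (due s)) else s.

(* A state at epoch 0. Orders outstanding then were placed at epochs in
   (-tau, 0]. *)
Definition admissible (s : state) : Prop :=
  (r < position s <= r + q)%N /\ {in due s, forall e, 0 < e <= tau}.

Variables (s0 : state) (x : nat -> R).

Definition arrival (n : nat) : R := \sum_(i < n.+1) x i.

Fixpoint after_arrivals (n : nat) : state :=
  if n is m.+1 then demand (arrival m) (deliver (arrival m) (after_arrivals m))
  else s0.

(* [fset_set] of an infinite set is empty, but almost surely only finitely many
   customers arrive by any epoch. *)
Definition arrival_count (t : R) : nat :=
  #|` fset_set [set n | arrival n <= t]|.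

Definition state_at (t : R) : state :=
  deliver t (after_arrivals (arrival_count t)).

End Dynamics.

Record lost_sales_system (R : realType) (r q : nat) (lam tau : R) :=
  LostSalesSystem {
    sys_display : measure_display;
    sample : measurableType sys_display;
    prob : probability sample R;
    interarrival : nat -> {RV prob >-> R};
    initial : state R;
    interarrivalP : poisson_interarrivals lam interarrival;
    initialP : admissible r q tau initial }.

Section Averages.
Variables (R : realType) (r q : nat) (lam tau : R).
Variable S : lost_sales_system r q lam tau.

Definition sys_state (w : sample S) (t : R) : state R :=
  state_at r q tau (initial S) (fun n => interarrival S n w) t.

Definition long_run_average (f : state R -> R) (v : R) : Prop :=
  {ae prob S, forall w,
    (\int[lebesgue_measure]_(t in `[0, T]) f (sys_state w t)) / T
      @[T --> +oo] --> v}.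

Definition stockout_fraction : R -> Prop :=
  long_run_average (fun s => (on_hand s == 0%N)%:R).
Definition average_on_hand : R -> Prop :=
  long_run_average (fun s => (on_hand s)%:R).
Definition average_on_order : R -> Prop :=
  long_run_average (fun s => (on_order q s)%:R).
Definition average_position : R -> Prop :=
  long_run_average (fun s => (position q s)%:R).

Definition long_run_averages (gamma L P U : R) : Prop :=
  [/\ stockout_fraction gamma, average_on_hand L,
      average_position P & average_on_order U].

End Averages.

(* Main.v *)
(** Arrivals see time averages: between two arrivals the position is constant
and stock becomes available after a time [u] known at the first of them, so
with [g] depending on the past, [g * (1{u <= y} - lam * max 0 (y - u))] has mean
zero and variance at most [g^2] for an exponential gap [y] of rate [lam].  The
sums of these terms therefore grow like the square root of the number of
arrivals, and along [4^k] arrivals they vanish almost surely after division by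
[4^k].  Hence the rate of served customers is [lam * (1 - gamma)], also when
each of them is weighted by the inventory position.

Little's law is the balance of [q] times the total residual lead time minus
[tau] times the position: this potential grows by [tau] per served customer and
decreases at rate [on_order].  The position decreases cyclically through
[r + 1, ..., r + q] at the served customers, so a discrete primitive of
[p - (r + (q + 1) / 2)] gives their mean position; during stockouts the
position is the only multiple of [q] in that range.

The formulas alone do not recover [gamma] from [P] or [L] when its coefficient
vanishes (e.g. [q = 1] for [P]), so [gamma] is shown to depend on the parameters
only: a long gap, [r + q] quick arrivals and another long gap erase the initial
state, this pattern almost surely occurs, and the interarrival times of any two
systems have the same law. *)
Require Import Defs.
From HB Require Import structures.
From mathcomp Require Import all_boot all_order all_algebra finmap.
From mathcomp Require Import all_classical all_reals all_analysis.
From mathcomp Require Import measurable_realfun zify ring lra.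
Set Implicit Arguments.
Unset Strict Implicit.
Unset Printing Implicit Defensive.
Import Order.TTheory GRing.Theory Num.Theory.
Import numFieldNormedType.Exports.
Local Open Scope classical_set_scope.
Local Open Scope ring_scope.

(** * Cylinders and independence *)

Section Cylinders.
Variable R : realType.

(** Boxes rather than arbitrary sets of the first [n] coordinates: they are closed under
    intersection, and mutual independence gives their probability directly as a product. *)
Definition cylinder (n : nat) : set (set (nat -> R)) :=
  [set A | exists B : nat -> set R,
    [/\ forall i, measurable (B i), forall i, (n <= i)%N -> B i = setT &
        A = [set x | forall i, B i (x i)]]].

Definition finite_cylinder : set (set (nat -> R)) := \bigcup_n cylinder n.

Lemma cylinderT n : cylinder n setT.
Proof.
by exists (fun=> setT); split=> //; apply/esym; rewrite -subTset => x.
Qed.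

Lemma cylinderI m n A B :
  cylinder m A -> cylinder n B -> cylinder (maxn m n) (A `&` B).
Proof.
move=> [a [ma Ta ->]] [b [mb Tb ->]]; exists (fun i => a i `&` b i); split.
- by move=> i; exact: measurableI.
- by move=> i; rewrite geq_max => /andP[mi ni]; rewrite Ta// Tb// setTI.
- by apply/seteqP; split=> x /= => [[xa xb] i|xab];
    [split|split=> i; have [] := xab i].
Qed.

Lemma cylinder_setI n : setI_closed (cylinder n).
Proof. by move=> A B cA cB; rewrite -(maxnn n); exact: cylinderI. Qed.

Lemma finite_cylinder_setI : setI_closed finite_cylinder.
Proof.
by move=> A B [m _ cA] [n _ cB]; exists (maxn m n) => //; exact: cylinderI.
Qed.

(** The carrier is the full sequence space for every [n]; only the sigma-algebra varies.
    Measurability from [past n] thus expresses adaptedness: dependence on the first [n] interarrival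
    times alone. *)
Definition past n := g_sigma_algebraType (cylinder n).
HB.instance Definition _ n := Measurable.on (past n).

Definition path_space := g_sigma_algebraType finite_cylinder.
HB.instance Definition _ := Measurable.on path_space.

Lemma cylinder_coord n i (B : set R) : (i < n)%N -> measurable B ->
  cylinder n [set x | B (x i)].
Proof.
move=> i_n mB; exists (fun j => if j == i then B else setT); split.
- by move=> j; case: eqP.
- by move=> j nj; rewrite ifN// gtn_eqF// (leq_trans i_n).
- apply/seteqP; split=> x /=; first by move=> xB j; case: eqP => // ->.
  by move/(_ i); rewrite eqxx.
Qed.

Lemma measurable_coord n i : (i < n)%N ->
  measurable_fun [set: past n] (fun x : past n => (x : nat -> R) i).
Proof.
move=> i_n _ B mB; rewrite setTI; apply: sub_sigma_algebra.
exact: cylinder_coord.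
Qed.

Lemma measurable_path_coord i :
  measurable_fun [set: path_space] (fun x : path_space => (x : nat -> R) i).
Proof.
move=> _ B mB; rewrite setTI; apply: sub_sigma_algebra.
by exists i.+1 => //; exact: cylinder_coord.
Qed.

Lemma measurable_set_widen (m n : nat) (A : set (nat -> R)) : (m <= n)%N ->
  measurable (A : set (past m)) -> measurable (A : set (past n)).
Proof.
move=> mn; apply: smallest_sub; first exact: smallest_sigma_algebra.
move=> _ [C [mC TC ->]]; apply: sub_sigma_algebra; exists C; split=> // i ni.
by apply: TC; exact: leq_trans ni.
Qed.

Lemma measurable_past_widen (m n : nat) (f : (nat -> R) -> R) : (m <= n)%N ->
  measurable_fun [set: past m] (f : past m -> R) ->
  measurable_fun [set: past n] (f : past n -> R).
Proof.
move=> mn mf _ B mB; have := mf measurableT B mB; rewrite !setTI.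
exact: measurable_set_widen.
Qed.

End Cylinders.

(** * Independence of the past and the next interarrival time *)

Section Independence.
Variables (R : realType) (d : measure_display) (Omega : measurableType d).
Variables (Pr : probability Omega R) (X : nat -> {RV Pr >-> R}).
Hypothesis indX : mutually_independent Pr X.

Definition sample_path (w : Omega) : nat -> R := fun i => X i w.

Lemma measurable_cylinder n (A : set (nat -> R)) :
  cylinder n A -> measurable (sample_path @^-1` A).
Proof.
move=> [B [mB TB ->]].
rewrite (_ : _ @^-1` _ = \bigcap_i (X i @^-1` B i)); last first.
  by apply/seteqP; split=> w /= wB i; [move=> _; exact: wB|exact: wB].
apply: bigcapT_measurable => i.
by rewrite -[_ @^-1` _]setTI; exact: measurable_funP.
Qed.

Definition path_past n (w : Omega) : past R n := sample_path w.

Definition full_path (w : Omega) : path_space R := sample_path w.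

Lemma measurable_path_past n : measurable_fun setT (path_past n).
Proof.
apply: (@measurability _ _ _ (past R n) _ _ (@cylinder R n)) => //.
move=> _ [A cA <-]; rewrite setTI; exact: measurable_cylinder cA.
Qed.

Lemma measurable_full_path : measurable_fun setT full_path.
Proof.
apply: (@measurability _ _ _ (path_space R) _ _ (@finite_cylinder R)) => //.
move=> _ [A [n _ cA] <-]; rewrite setTI; exact: measurable_cylinder cA.
Qed.

HB.instance Definition _ n :=
  isMeasurableFun.Build _ _ _ _ (path_past n) (@measurable_path_past n).

HB.instance Definition _ :=
  isMeasurableFun.Build _ _ _ _ full_path measurable_full_path.

Lemma prob_cylinder (B : nat -> set R) n : (forall i, measurable (B i)) ->
  (forall i, (n <= i)%N -> B i = setT) ->
  Pr (sample_path @^-1` [set x | forall i, B i (x i)]) =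
  (\prod_(i <- iota 0 n) Pr (X i @^-1` B i))%E.
Proof.
move=> mB TB; pose J := [fset i in iota 0 n]%fset.
have JE i : (i \in J) = (i < n)%N by rewrite in_fset/= mem_iota.
transitivity (\prod_(i <- J) Pr (X i @^-1` B i))%E.
  rewrite -indX//; congr (Pr _); apply/seteqP; split=> w /=.
    by move=> wB i _; exact: wB.
  move=> wB i; have [i_n|ni] := ltnP i n; last by rewrite TB.
  by apply: wB; rewrite /= JE.
apply: perm_big; apply: uniq_perm; rewrite ?iota_uniq ?fset_uniq// => i.
by rewrite JE mem_iota.
Qed.

Lemma prob_cylinder_next n (A : set (nat -> R)) (C : set R) :
  cylinder n A -> measurable C ->
  Pr (sample_path @^-1` A `&` X n @^-1` C) =
  (Pr (sample_path @^-1` A) * Pr (X n @^-1` C))%E.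
Proof.
move=> [B [mB TB ->]] mC; pose B' (i : nat) := if i == n then C else B i.
rewrite (_ : _ `&` _ = sample_path @^-1` [set x | forall i, B' i (x i)]); last first.
  apply/seteqP; split=> w /=.
    by move=> [wB wC] i; rewrite /B'; case: eqP => // ->.
  move=> wB'; split=> [i|]; last by have := wB' n; rewrite /B' eqxx.
  by have := wB' i; rewrite /B'; case: eqP => // ->; rewrite TB.
rewrite (@prob_cylinder B' n.+1); last 2 first.
  by move=> i; rewrite /B'; case: eqP.
  by move=> i ni; rewrite /B' gtn_eqF// TB// ltnW.
rewrite (@prob_cylinder B n)// -addn1 iotaD big_cat/= big_seq1 /B' add0n eqxx.
congr (_ * _)%E; rewrite !big_seq; apply: eq_bigr => i.
by rewrite mem_iota add0n => /andP[_ /ltn_eqF ->].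
Qed.

(** As functions of [A], the two sides are finite measures: [Pr] restricted to the event on [X n],
    and [Pr] scaled by the probability of that event. They agree on preimages of cylinders, a
    pi-system generating the preimages of all [past n] events. *)
Lemma prob_past_next n (A : set (past R n)) (C : set R) :
  measurable A -> measurable C ->
  Pr (sample_path @^-1` A `&` X n @^-1` C) =
  (Pr (sample_path @^-1` A) * Pr (X n @^-1` C))%E.
Proof.
move=> mA mC.
have mXC : measurable (X n @^-1` C).
  by rewrite -[_ @^-1` _]setTI; exact: measurable_funP.
pose k : {nonneg R} := NngNum (fine_ge0 (measure_ge0 Pr (X n @^-1` C))).
have kE : (k%:num)%:E = Pr (X n @^-1` C) by rewrite fineK// fin_num_measure.
pose m1 := mrestr Pr mXC; pose m2 := mscale k Pr.
rewrite muleC -kE; change (m1 (sample_path @^-1` A) = m2 (sample_path @^-1` A)).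
pose G := preimage_set_system setT sample_path (@cylinder R n).
apply: (g_sigma_algebra_measure_unique G _ (fun=> setT)) => //.
- by move=> _ [A' cA' <-]; rewrite setTI; exact: measurable_cylinder cA'.
- by move=> _; exists setT; [exact: cylinderT|rewrite setTI preimage_setT].
- by rewrite bigcup_const//; exists 0%N.
- move=> _ _ [A1 cA1 <-] [A2 cA2 <-]; exists (A1 `&` A2).
    exact: cylinder_setI.
  by rewrite !setTI preimage_setI.
- move=> _ [A' cA' <-]; rewrite setTI /= /mrestr /mscale kE muleC.
  exact: prob_cylinder_next.
- move=> _ /=; rewrite /mrestr setTI.
  by rewrite (le_lt_trans (probability_le1 _ _))// ltry.
- rewrite /G g_sigma_preimageE; exists A => //; exact: setTI.
Qed.

(* [lebesgue_measure] lives on [measurableTypeR R], whose display is not the one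
   of the canonical instance of [R]. *)
Definition coordR n (w : Omega) : measurableTypeR R := X n w.

Lemma measurable_coordR n : measurable_fun setT (coordR n).
Proof. exact: measurable_funP (X n). Qed.

HB.instance Definition _ n :=
  isMeasurableFun.Build _ _ _ _ (coordR n) (@measurable_coordR n).

Definition path_split n (w : Omega) : (past R n * measurableTypeR R)%type :=
  (path_past n w, coordR n w).

Lemma measurable_path_split n : measurable_fun setT (path_split n).
Proof. by apply: measurable_fun_pair; exact: measurable_funP. Qed.

HB.instance Definition _ n :=
  isMeasurableFun.Build _ _ _ _ (path_split n) (@measurable_path_split n).

(** By [prob_past_next] the joint law of the past and the next coordinate is the product of its
    marginals, so Tonelli applies. This plays the part of conditioning on the past. *)
Lemma ge0_integral_path_split n (f : past R n * measurableTypeR R -> \bar R) :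
  measurable_fun setT f -> (forall z, 0 <= f z)%E ->
  (\int[Pr]_w f (path_split n w) =
   \int[distribution Pr (path_past n)]_v
     \int[distribution Pr (coordR n)]_y f (v, y))%E.
Proof.
move=> mf f0.
have := @fubini_tonelli1 _ _ _ _ _ (distribution Pr (path_past n))
  (distribution Pr (coordR n)) f mf f0.
rewrite /fubini_F => <-.
have /= <- := @ge0_integral_distribution _ _ _ _ _ Pr (path_split n) f mf f0.
apply: eq_measure_integral => A mA _; apply/esym.
apply: product_measure_unique => //= A' C mA' mC.
exact: prob_past_next.
Qed.

End Independence.

(** * Exponential integrals *)

Section Density.
Context d (T : measurableType d) (R : realType).
Variables (mu nu : {measure set T -> \bar R}) (g : T -> R).
Hypotheses (g0 : forall x, 0 <= g x) (mg : measurable_fun setT g).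
Hypothesis nuE :
  forall A, measurable A -> nu A = (\int[mu]_(x in A) (g x)%:E)%E.

Import HBNNSimple.

Let integral_density_nnsfun (h : {nnsfun T >-> R}) :
  (\int[nu]_x (h x)%:E = \int[mu]_x ((h x)%:E * (g x)%:E))%E.
Proof.
under [LHS]eq_integral do rewrite fimfunE -fsumEFin//.
rewrite [LHS]ge0_integral_fsum//; last 2 first.
  - by move=> r; exact/measurable_EFinP/measurableT_comp.
  - by move=> n x _; rewrite EFinM nnfun_muleindic_ge0.
under [RHS]eq_integral.
  move=> x xD; rewrite fimfunE -fsumEFin// ge0_mule_fsuml; last first.
    by move=> r; rewrite EFinM nnfun_muleindic_ge0.
  over.
have mi r : measurable_fun setT (fun x => (r * \1_(h @^-1` [set r]) x)%:E).
  by apply/measurable_EFinP/measurable_funM => //.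
rewrite [RHS]ge0_integral_fsum//; last 2 first.
  - by move=> r; apply: emeasurable_funM => //; exact/measurable_EFinP.
  - move=> n x _; rewrite EFinM mule_ge0//; last by rewrite lee_fin.
    by rewrite nnfun_muleindic_ge0.
apply: eq_fsbigr => r _.
rewrite integralZl_indic_nnsfun//= integral_indic//= setIT nuE//.
have [r0|r0] := leP 0 r; last first.
  rewrite preimage_nnfun0// integral_set0 mule0 integral0_eq// => x _.
  by rewrite indicE in_set0 mulr0 mul0e.
rewrite -ge0_integralZl//; last 2 first.
  - by apply/measurable_EFinP; exact: measurable_funTS.
  - by move=> x _; rewrite lee_fin.
rewrite integral_mkcond; apply: eq_integral => x _.
by rewrite patchE indicE; case: ifPn => _; rewrite ?mulr1 ?mulr0 ?mul0e.
Qed.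

(** Simple functions first, then monotone convergence on both sides along the same
    approximations. *)
Lemma ge0_integral_density (f : T -> \bar R) :
  measurable_fun setT f -> (forall x, 0 <= f x)%E ->
  (\int[nu]_x f x = \int[mu]_x (f x * (g x)%:E))%E.
Proof.
move=> mf f0; pose h := nnsfun_approx measurableT mf.
transitivity (limn (fun n => \int[nu]_x (h n x)%:E))%E.
  rewrite -monotone_convergence//=.
  - apply: eq_integral => x _; apply/esym/cvg_lim => //.
    exact: cvg_nnsfun_approx.
  - by move=> n; exact/measurable_EFinP.
  - by move=> n x _; rewrite lee_fin.
  - by move=> x _ a b ab; rewrite lee_fin; exact/lefP/nd_nnsfun_approx.
under eq_fun do rewrite integral_density_nnsfun.
rewrite -monotone_convergence//=.
- apply: eq_integral => x _; apply/cvg_lim => //.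
  by apply: cvgeZr => //; exact: cvg_nnsfun_approx.
- by move=> n; apply: emeasurable_funM; exact/measurable_EFinP.
- by move=> n x _; rewrite mule_ge0// lee_fin.
- move=> x _ a b ab; rewrite lee_wpmul2r ?lee_fin//.
  exact/lefP/nd_nnsfun_approx.
Qed.

End Density.

(** * Second moments under the exponential law *)

Section Exponential.
Variable R : realType.
Notation mu := (@lebesgue_measure R).
Variables (lam : R) (lam0 : 0 < lam).
(* Antiderivative of [(b + g - g lam (y - u))^2 lam exp (- lam y)] *)
Definition compensated_primitive (b g u y : R) : R :=
  - (expR (- lam * y) * ((b - g * (lam * (y - u))) ^+ 2 + g ^+ 2)).

Lemma derive_compensated_primitive (b g u y : R) :
  is_derive y 1 (compensated_primitive b g u)
    ((b + g - g * (lam * (y - u))) ^+ 2 * (lam * expR (- lam * y))).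
Proof.
rewrite /compensated_primitive; apply: is_derive_eq.
rewrite !/GRing.scale/=; ring.
Qed.

Lemma compensated_primitive_cvg (b g u : R) : 0 <= u ->
  compensated_primitive b g u y @[y --> +oo] --> 0.
Proof.
(* With [w y = 1 + lam * y / 3], the polynomial factor is at most [C * w y ^+ 2], since
   [lam * (y - u) <= 3 * w y], while [expR (lam * y) >= w y ^+ 3] by cubing [expR z >= 1 + z]. The
   quotient is at most [C / w y]. *)
move=> u0; pose C := (`|b| + 3 * `|g|) ^+ 2 + g ^+ 2.
have C0 : 0 <= C by rewrite addr_ge0// sqr_ge0.
pose w y := 1 + lam * y / 3.
have wy : (C / w y) @[y --> +oo] --> (0 : R).
  rewrite -(mulr0 C); apply: cvgMr; apply/gtr0_cvgV0.
    near=> y; have y0 : 0 <= y.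
      by near: y; apply: nbhs_pinfty_ge; exact: num_real.
    by rewrite /w ltr_pwDl// divr_ge0// mulr_ge0 // ltW.
  apply/cvgryPge => A; near=> y.
  rewrite /w -lerBlDl ler_pdivlMr// -ler_pdivrMl//.
apply/norm_cvg0P.
apply: squeeze_cvgr (cvg_cst 0) wy; near=> y.
have uy : u <= y by near: y; apply: nbhs_pinfty_ge; exact: num_real.
have w1 : 1 <= w y.
  by rewrite /w lerDl divr_ge0// mulr_ge0 ?(ltW lam0)// (le_trans u0).
have w0 : 0 < w y by exact: lt_le_trans w1.
rewrite normr_ge0/= /compensated_primitive normrN normrM ger0_norm ?expR_ge0//.
rewrite ger0_norm ?addr_ge0 ?sqr_ge0//.
have e3 : w y ^+ 3 <= expR (lam * y).
  have -> : lam * y = lam * y / 3 *+ 3 by rewrite -mulr_natr; field.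
  rewrite -mulr_natl expRM_natl lerXn2r ?nnegrE ?expR_ge0 ?(ltW w0)//.
  exact: expR_ge1Dx.
rewrite mulNr expRN ler_pdivrMl ?expR_gt0//.
apply: (@le_trans _ _ (w y ^+ 3 * (C / w y))); last first.
  by rewrite ler_wpM2r// divr_ge0// ltW.
rewrite (_ : w y ^+ 3 * _ = C * w y ^+ 2); last by field; exact: lt0r_neq0.
rewrite /C mulrDl lerD//; last by rewrite ler_peMr ?sqr_ge0// exprn_ege1.
rewrite -exprMn -[leLHS]real_normK ?num_real// lerXn2r ?nnegrE//.
  by rewrite mulr_ge0 ?addr_ge0 ?mulr_ge0// ltW.
rewrite (le_trans (ler_normB _ _))// mulrDl lerD ?ler_peMr//.
rewrite normrM -mulrA mulrCA ler_wpM2l//.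
rewrite ger0_norm ?mulr_ge0 ?subr_ge0 ?(ltW lam0)//.
have lu0 : 0 <= lam * u by rewrite mulr_ge0// ltW.
by rewrite /w; lra.
Unshelve. all: end_near. Qed.

Lemma integral_exponential_tail (b g u : R) : 0 <= u ->
  (\int[mu]_(y in `[u, +oo[)
     ((b + g - g * (lam * (y - u))) ^+ 2 * exponential_pdf lam y)%:E =
   (expR (- lam * u) * (b ^+ 2 + g ^+ 2))%:E)%E.
Proof.
move=> u0; pose F := compensated_primitive b g u.
pose f y := (b + g - g * (lam * (y - u))) ^+ 2 * (lam * expR (- lam * y)).
have dF (y : R) : is_derive y 1 F (f y) by exact: derive_compensated_primitive.
have df (y : R) : derivable f y 1 by exact: ex_derive.
transitivity (\int[mu]_(y in `[u, +oo[) (f y)%:E)%E.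
  apply: eq_integral => y /[!inE]/= /[!in_itv]/= /andP[uy _].
  by rewrite exponential_pdfE// (le_trans u0).
rewrite (@ge0_continuous_FTC2y _ f F u 0).
- by rewrite sub0e -EFinN /F /compensated_primitive subrr mulr0 mulr0 subr0 opprK.
- by move=> y _; rewrite mulr_ge0 ?sqr_ge0// mulr_ge0 ?expR_ge0// ltW.
- apply: continuous_subspaceT => y.
  by apply: differentiable_continuous; apply/derivable1_diffP; exact: df.
- exact: compensated_primitive_cvg.
- by move=> y _; exact: ex_derive.
- apply: cvg_at_right_filter; apply: differentiable_continuous.
  by apply/derivable1_diffP; exact: ex_derive.
- by move=> y _; rewrite derive1E; exact: derive_val.
Qed.

Lemma exponential_prob_itvcy (u : R) : 0 <= u ->
  exponential_prob lam `[u, +oo[ = (expR (- lam * u))%:E.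
Proof.
move=> u0; have := @integral_exponential_tail 1 0 u u0.
rewrite expr1n expr0n addr0 mulr1 => <-; apply: eq_integral => y _.
by rewrite mul0r subr0 expr1n mul1r.
Qed.

Variable nu : {measure set (measurableTypeR R) -> \bar R}.
Hypothesis nuE : forall B, measurable B -> nu B = exponential_prob lam B.

(** Below [u] the integrand is [b ^+ 2], with mass [1 - expR (- lam * u)]; the tail contributes
    [expR (- lam * u) * (b ^+ 2 + g ^+ 2)]. No cross term in [b * g] survives, because the
    compensated indicator has mean zero. *)
Lemma integral_compensated_square (b g u : R) : 0 <= u ->
  (\int[nu]_y
     ((b + g * ((u <= y)%R%:R - lam * Num.max 0 (y - u))) ^+ 2)%:E <=
   (b ^+ 2 + g ^+ 2)%:E)%E.
Proof.
move=> u0.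
have mind : measurable_fun setT (fun y : R => (u <= y)%R%:R : R).
  rewrite (_ : (fun y : R => _) = \1_(`[u, +oo[)); last first.
    by apply/funext => y; rewrite indicE mem_setE in_itv/= andbT.
  exact: measurable_indic.
pose h y : R := (b + g * ((u <= y)%R%:R - lam * Num.max 0 (y - u))) ^+ 2.
have mh : measurable_fun setT h.
  apply: measurable_funX; apply: measurable_funD => //.
  apply: measurable_funM => //; apply: measurable_funB => //.
  apply: measurable_funM => //; apply: measurable_maxr => //.
  exact: measurable_funB.
rewrite (@ge0_integral_density _ _ _ mu nu (exponential_pdf lam))//=; last 4 first.
- by move=> x; rewrite exponential_pdf_ge0// ltW.
- exact: measurable_exponential_pdf.
- exact/measurable_EFinP.
- by move=> x; rewrite lee_fin sqr_ge0.
have mpdf := @measurable_exponential_pdf R lam.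
have pdf0 y : 0 <= exponential_pdf lam y by rewrite exponential_pdf_ge0// ltW.
have mI : measurable (`[u, +oo[%classic : set (measurableTypeR R)) by [].
have IC : [disjoint `[u, +oo[%classic & ~` `[u, +oo[%classic : set R].
  by apply/disj_setPCl.
rewrite -(setUv (`[u, +oo[%classic : set (measurableTypeR R))).
rewrite ge0_integral_setU//=; last 3 first.
- exact: measurableC.
- rewrite setUv; apply: emeasurable_funM; exact/measurable_EFinP.
- by move=> x _; rewrite mule_ge0// lee_fin// sqr_ge0.
have head1 : (\int[mu]_(y in ~` `[u, +oo[) (exponential_pdf lam y)%:E =
    (1 - expR (- lam * u))%:E)%E.
  have := integral_exponential_pdf lam0.
  rewrite -(setUv (`[u, +oo[%classic : set (measurableTypeR R))).
  rewrite ge0_integral_setU//=; last 3 first.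
  - exact: measurableC.
  - by rewrite setUv; exact/measurable_EFinP.
  - by move=> x _; rewrite lee_fin.
  rewrite [X in (X + _)%E](exponential_prob_itvcy u0) EFinB => <-.
  by rewrite addeAC subee// add0e.
rewrite [X in (X + _)%E](_ : _ =
    (expR (- lam * u) * (b ^+ 2 + g ^+ 2))%:E); last first.
  rewrite -(integral_exponential_tail _ _ u0).
  apply: eq_integral => y /[!inE]/= /[!in_itv]/= /andP[uy _].
  rewrite -EFinM; congr ((_ ^+ 2 * _)%:E).
  by rewrite uy max_r ?subr_ge0// mulrBr mulr1 addrA.
rewrite [X in (_ + X)%E](_ : _ = (b ^+ 2 * (1 - expR (- lam * u)))%:E); last first.
  rewrite EFinM -head1 -ge0_integralZl//=.
  - apply: eq_integral => y /[!inE]/= /[!in_itv]/= /negP.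
    rewrite andbT -ltNge => yu.
    by rewrite leNgt yu max_l ?subr_le0 ?ltW// mulr0 subr0 mulr0 addr0.
  - exact: measurableC.
  - apply/measurable_EFinP; exact: measurable_funTS.
  - by move=> x _; rewrite lee_fin.
  - by rewrite lee_fin sqr_ge0.
rewrite -EFinD lee_fin.
have e1 : expR (- lam * u) <= 1.
  by rewrite -expR0 ler_expR mulNr oppr_le0 mulr_ge0// ltW.
have : 0 <= g ^+ 2 * (1 - expR (- lam * u)) by rewrite mulr_ge0 ?sqr_ge0 ?subr_ge0.
by lra.
Qed.

End Exponential.

(** * The compensated arrival sums *)

Section Martingale.
Variables (R : realType) (d : measure_display) (Omega : measurableType d).
Variables (Pr : probability Omega R) (X : nat -> {RV Pr >-> R}).
Variables (lam : R) (lam0 : 0 < lam).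
Hypothesis XP : poisson_interarrivals lam X.

(** A martingale transform when [g k] and [u k] are adapted. They take the whole sequence as
    argument; that they look only at its first [k] entries is the content of the hypotheses [mg] and
    [mu]. *)
Definition compensated (g u : nat -> (nat -> R) -> R) (n : nat)
    (x : nat -> R) : R :=
  \sum_(k < n) g k x *
    ((u k x <= x k)%R%:R - lam * Num.max 0 (x k - u k x)).

Variables (g u : nat -> (nat -> R) -> R) (K : R).
Hypothesis mg : forall n, measurable_fun [set: past R n] (g n : past R n -> R).
Hypothesis mu : forall n, measurable_fun [set: past R n] (u n : past R n -> R).
Hypothesis gK : forall n x, `|g n x| <= K.
Hypothesis u0 : forall n x, 0 <= u n x.

Lemma measurable_le_fun d' (T : measurableType d') (f h : T -> R) :
  measurable_fun setT f -> measurable_fun setT h ->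
  measurable_fun setT (fun t => (f t <= h t)%R%:R : R).
Proof.
move=> mf mh; rewrite (_ : (fun _ => _) = \1_[set t | f t <= h t]).
  apply: measurable_indic; rewrite -[X in measurable X]setTI.
  exact: measurable_fun_le.
by apply/funext => t; rewrite indicE mem_setE.
Qed.

Lemma measurable_compensated n :
  measurable_fun [set: past R n] (compensated g u n : past R n -> R).
Proof.
apply: measurable_sum => k.
have mx : measurable_fun [set: past R n] (fun x : past R n => (x : nat -> R) k).
  exact: measurable_coord.
have kn : (k <= n)%N by exact: ltnW.
apply: measurable_funM; first exact: (@measurable_past_widen R k n (g k)).
have mu' : measurable_fun [set: past R n] (u k : past R n -> R).
  exact: (@measurable_past_widen R k n (u k)).
apply: measurable_funB; first exact: measurable_le_fun.
apply: measurable_funM => //; apply: measurable_maxr => //.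
exact: measurable_funB.
Qed.

(** Induction splitting off the last coordinate: with the past fixed at [v], the inner integral is
    at most [M v ^+ 2 + g n v ^+ 2], so the second moment grows by at most [K ^+ 2] per step. *)
Lemma integral_compensated_sqr n :
  (\int[Pr]_w (compensated g u n (sample_path X w) ^+ 2)%:E <=
   (n%:R * K ^+ 2)%:E)%E.
Proof.
elim: n => [|n IHn].
  under eq_integral do rewrite /compensated big_ord0 expr0n/=.
  by rewrite integral0 mul0r.
pose M : past R n -> R := compensated g u n.
have mM : measurable_fun setT M by exact: measurable_compensated.
pose f (z : past R n * measurableTypeR R) : \bar R := ((M z.1 + g n z.1 *
  ((u n z.1 <= z.2)%R%:R - lam * Num.max 0 (z.2 - u n z.1))) ^+ 2)%:E.
have mf : measurable_fun setT f.
  have m1 (h : past R n -> R) : measurable_fun setT h ->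
      measurable_fun setT (fun z : past R n * measurableTypeR R => h z.1).
    by move=> mh; exact: measurableT_comp mh measurable_fst.
  have m2 : measurable_fun setT
      (fun z : past R n * measurableTypeR R => z.2 : R).
    exact: measurable_snd.
  apply/measurable_EFinP; apply: measurable_funX.
  apply: measurable_funD; first exact: m1.
  apply: measurable_funM; first exact: m1 (@mg n).
  have mU := m1 _ (@mu n).
  apply: measurable_funB; first exact: measurable_le_fun.
  apply: measurable_funM => //; apply: measurable_maxr => //.
  exact: measurable_funB.
have f0 z : (0 <= f z)%E by rewrite lee_fin sqr_ge0.
rewrite (_ : (fun _ => _) = fun w => f (path_split X n w)); last first.
  by apply/funext => w; rewrite /compensated big_ord_recr.
rewrite ge0_integral_path_split//; last exact: (proj1 XP).
apply: (@le_trans _ _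
    (\int[distribution Pr (path_past X n)]_v (M v ^+ 2 + K ^+ 2)%:E)%E).
  apply: ge0_le_integral => //=.
  - by move=> v _; exact: integral_ge0.
  - exact: (@measurable_fun_fubini_tonelli_F _ _ _ _ _
      (distribution Pr (coordR X n)) f).
  - by apply/measurable_EFinP; apply: measurable_funD => //;
      exact: measurable_funX.
  - move=> v _; apply: (@le_trans _ _ (M v ^+ 2 + g n v ^+ 2)%:E).
      have nuE B : measurable B ->
          distribution Pr (coordR X n) B = exponential_prob lam B.
        by move=> mB; have [_ /(_ n B mB)] := XP.
      have := @integral_compensated_square R lam lam0
        (distribution Pr (coordR X n)) nuE (M v) (g n v) (u n v).
      by apply; exact: u0.
    by rewrite lee_fin lerD2l -real_normK ?num_real// lerXn2r ?nnegrE//;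
      exact: le_trans (gK n v).
under eq_integral do rewrite EFinD.
rewrite ge0_integralD//=; last 3 first.
- by move=> v _; rewrite lee_fin sqr_ge0.
- by apply/measurable_EFinP; exact: measurable_funX.
- by move=> v _; rewrite lee_fin sqr_ge0.
rewrite integral_cst//= probability_setT mule1.
rewrite ge0_integral_distribution//; last 2 first.
- by apply/measurable_EFinP; exact: measurable_funX.
- by move=> v; rewrite lee_fin sqr_ge0.
by rewrite -natr1 mulrDl mul1r EFinD leeD2r.
Qed.

(** The mean square of the [k]-th ratio is at most [K ^+ 2 / 4 ^ k]. This is summable, so the series
    of squares is integrable, hence almost surely finite, and its terms tend to zero. The geometric
    subsequence is what makes a second moment bound suffice. *)
Lemma compensated_cvg : {ae Pr, forall w,
  compensated g u (4 ^ k) (sample_path X w) / (4 ^ k)%:R @[k --> \oo] --> (0 : R)}.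
Proof.
pose Z k w := ((compensated g u (4 ^ k) (sample_path X w) / (4 ^ k)%:R) ^+ 2)%:E.
have Z0 k w : (0 <= Z k w)%E by rewrite lee_fin sqr_ge0.
have mM n : measurable_fun setT (fun w => compensated g u n (sample_path X w)).
  exact: measurableT_comp (@measurable_compensated n)
    (@measurable_path_past _ _ _ _ X n).
have mZ k : measurable_fun setT (Z k).
  apply/measurable_EFinP; apply: measurable_funX.
  exact: measurable_funM.
have intZ k : (\int[Pr]_w Z k w <= (geometric (K ^+ 2) 4^-1 k)%:E)%E.
  have k0 : 0 < (4 ^ k)%:R :> R by rewrite ltr0n expn_gt0.
  rewrite /Z (_ : (fun _ => _) = fun w => (((4 ^ k)%:R ^- 2)%:E *
      (compensated g u (4 ^ k) (sample_path X w) ^+ 2)%:E)%E); last first.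
    by apply/funext => w; rewrite -EFinM exprMn exprVn mulrC.
  rewrite ge0_integralZl//=; last 2 first.
  - by apply/measurable_EFinP; exact: measurable_funX.
  - by move=> w _; rewrite lee_fin sqr_ge0.
  apply: le_trans (lee_wpmul2l _ (integral_compensated_sqr _)) _.
    by rewrite lee_fin invr_ge0 sqr_ge0.
  rewrite -EFinM lee_fin natrX exprVn le_eqVlt; apply/orP; left; apply/eqP.
  by field; rewrite expf_neq0.
have sumZ : (\sum_(k <oo) \int[Pr]_w Z k w < +oo)%E.
  apply: (@le_lt_trans _ _ (K ^+ 2 / (1 - 4^-1))%:E); last exact: ltry.
  apply: lime_le.
    by apply: is_cvg_nneseries => n _ _; exact: integral_ge0.
  apply: nearW => n.
  apply: (@le_trans _ _ (\sum_(0 <= k < n) (geometric (K ^+ 2) 4^-1 k)%:E)%E).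
    exact: lee_sum.
  rewrite sumEFin lee_fin; apply: geometric_le_lim; rewrite ?sqr_ge0//.
  by rewrite ger0_norm// invf_lt1// ltr1n.
rewrite -integral_nneseries// in sumZ.
have mS : measurable_fun setT (fun w => \sum_(k <oo) Z k w)%E.
  exact: ge0_emeasurable_sum.
have S0 w : (0 <= \sum_(k <oo) Z k w)%E by exact: nneseries_ge0.
have iS : Pr.-integrable setT (fun w => \sum_(k <oo) Z k w)%E.
  apply/integrableP; split=> //.
  by under eq_integral do rewrite gee0_abs//.
have := integrable_ae measurableT iS.
apply: filterS => w /(_ I) Sw.
pose z k := (compensated g u (4 ^ k) (sample_path X w) / (4 ^ k)%:R) ^+ 2.
have : cvgn (series z).
  apply: nondecreasing_is_cvgn.
    by apply: nondecreasing_series => k _ _; exact: sqr_ge0.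
  exists (fine (\sum_(k <oo) Z k w)%E) => _ [n _ <-].
  rewrite -lee_fin fineK// /series/= -sumEFin.
  exact: (@nneseries_lim_ge R (Z ^~ w) xpredT 0 n).
move=> /(@cvg_series_cvg_0 _ R^o) /cvgr0Pnorm_lt z0.
apply/cvgr0Pnorm_lt => e e0; have := z0 (e ^+ 2) (exprn_gt0 _ e0).
apply: filterS => k; rewrite /z normrX => zk.
by rewrite -(ltr_pXn2r (n := 2)) ?nnegrE ?(ltW e0).
Qed.

End Martingale.

(** * Patterns of interarrival times *)

Section Patterns.
Variables (R : realType) (d : measure_display) (Omega : measurableType d).
Variables (Pr : probability Omega R) (X : nat -> {RV Pr >-> R}) (lam : R).
Hypothesis XP : poisson_interarrivals lam X.
Variables (m : nat) (B : nat -> set R).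
Hypothesis mB : forall i, measurable (B i).
Hypothesis B0 : forall i, (0 < exponential_prob lam (B i))%E.

Definition pattern_at (n j : nat) : set (nat -> R) :=
  [set x | forall i, (i < j)%N -> B i (x (n + i)%N)].

Lemma measurable_pattern_at n j k : (n + j <= k)%N ->
  measurable (pattern_at n j : set (past R k)).
Proof.
move=> njk; rewrite (_ : pattern_at n j = \bigcap_i
    [set x : past R k | (i < j)%N -> B i ((x : nat -> R) (n + i)%N)]); last first.
  by apply/seteqP; split=> x /= xB i; [move=> _; exact: xB|exact: xB].
apply: bigcapT_measurable => i; have [ij|ji] := ltnP i j; last first.
  by rewrite [X in measurable X](_ : _ = setT)//; apply/seteqP; split.
rewrite [X in measurable X](_ : _ =
    [set x : past R k | B i ((x : nat -> R) (n + i)%N)]); last first.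
  by apply/seteqP; split=> x /= xB; [exact: xB|move=> _].
rewrite -[X in measurable X]setTI.
by apply: measurable_coord; [rewrite (leq_trans _ njk)// ltn_add2l| |exact: mB].
Qed.

Lemma prob_pattern_at n j (A : set (past R n)) : measurable A ->
  Pr (sample_path X @^-1` (A `&` pattern_at n j)) =
  (Pr (sample_path X @^-1` A) * \prod_(i < j) exponential_prob lam (B i))%E.
Proof.
move=> mA; elim: j => [|j IHj].
  rewrite big_ord0 mule1 (_ : pattern_at n 0 = setT) ?setIT//.
  by apply/seteqP; split.
rewrite big_ord_recr/= muleA -IHj -(proj2 XP (n + j)%N)//.
have mAj : measurable (A `&` pattern_at n j : set (past R (n + j))).
  apply: measurableI; last exact: measurable_pattern_at.
  by apply: measurable_set_widen mA; exact: leq_addr.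
apply: etrans (prob_past_next (proj1 XP) mAj (mB j)).
congr (Pr _); apply/seteqP; split=> w /=.
  by move=> [Aw wB]; split; [split=> // i ij; apply: wB; exact: ltnW|exact: wB].
move=> [[Aw wB] wBj]; split=> // i.
by rewrite ltnS leq_eqVlt => /predU1P[->//|]; exact: wB.
Qed.

Lemma measurable_path_preimage n (A : set (past R n)) :
  measurable A -> measurable (sample_path X @^-1` A).
Proof.
move=> mA; rewrite -[X in measurable X]setTI.
exact: (@measurable_path_past _ _ _ _ X n).
Qed.

(** Only windows starting at multiples of [m] are examined, so that distinct windows involve
    disjoint sets of coordinates. *)
Definition no_pattern (b : nat) : set (nat -> R) :=
  [set x | forall c, (c < b)%N -> ~ pattern_at (c * m) m x].

Lemma measurable_no_pattern b :
  measurable (no_pattern b : set (past R (b * m))).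
Proof.
rewrite (_ : no_pattern b = \bigcap_c
    [set x : past R (b * m) | (c < b)%N -> (~` pattern_at (c * m) m) x]); last first.
  by apply/seteqP; split=> x /= xB i; [move=> _; exact: xB|exact: xB].
apply: bigcapT_measurable => c; have [cb|bc] := ltnP c b; last first.
  by rewrite [X in measurable X](_ : _ = setT)//; apply/seteqP; split.
rewrite [X in measurable X](_ : _ = ~` pattern_at (c * m) m); last first.
  by apply/seteqP; split=> x /= xB; [exact: xB|move=> _].
apply: measurableC; apply: measurable_pattern_at.
by rewrite -mulSnr leq_mul2r cb orbT.
Qed.

Let p : \bar R := (\prod_(i < m) exponential_prob lam (B i))%E.

Let exp01 i : (0 < exponential_prob lam (B i) <= 1)%E.
Proof. by rewrite B0 -(proj2 XP 0%N)// probability_le1. Qed.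

Let p01 : (0 < p <= 1)%E.
Proof.
rewrite /p; elim/big_rec: _ => [|i y _ /andP[y0 y1]]; first by rewrite lte01/=.
have /andP[e0 e1] := exp01 i.
by rewrite mule_gt0// -[leRHS]mule1 lee_pmul// ltW.
Qed.

(** The paths lost in passing from [b] to [b + 1] windows are those with the pattern in window [b],
    an event independent of the earlier windows and of probability [p]. *)
Lemma prob_no_pattern b :
  Pr (sample_path X @^-1` no_pattern b) = ((1 - fine p) ^+ b)%:E.
Proof.
have fp : p \is a fin_num.
  have /andP[p0 p1] := p01.
  by rewrite ge0_fin_numE ?(ltW p0)// (le_lt_trans p1)// ltry.
elim: b => [|b IHb].
  rewrite expr0 (_ : _ @^-1` _ = setT) ?probability_setT//.
  by apply/seteqP; split.
have mN := @measurable_no_pattern b.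
have mXN : measurable (sample_path X @^-1` no_pattern b).
  exact: measurable_path_preimage mN.
have mXP : measurable (sample_path X @^-1` (no_pattern b `&` pattern_at (b * m) m)).
  apply: (@measurable_path_preimage (b * m + m)).
  apply: measurableI; last exact: measurable_pattern_at.
  by apply: measurable_set_widen mN; exact: leq_addr.
rewrite (_ : _ @^-1` _ = sample_path X @^-1` no_pattern b `\`
    sample_path X @^-1` (no_pattern b `&` pattern_at (b * m) m)); last first.
  apply/seteqP; split=> w /=.
    move=> nw; split=> [c cb|[_]]; first by apply: nw; exact: ltnW.
    exact: nw.
  move=> [nw nP] c; rewrite ltnS leq_eqVlt => /predU1P[->|]; last exact: nw.
  by move=> wP; exact: nP.
rewrite measureD// ?(le_lt_trans (probability_le1 _ _)) ?ltry//.
rewrite setIidr; last by move=> w [].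
rewrite [X in (_ - X)%E](_ : _ = (((1 - fine p) ^+ b)%:E * p)%E); last first.
  by rewrite -IHb; exact: (prob_pattern_at m mN).
rewrite [X in (X - _)%E](_ : _ = ((1 - fine p) ^+ b)%:E)//.
move: fp; case: (p) => // z _ /=.
by rewrite -EFinB exprSr mulrBr mulr1.
Qed.

(** Paths avoiding the pattern in every window have probability at most [(1 - p) ^ b] for each [b],
    with [p > 0]. *)
Lemma pattern_almost_surely :
  {ae Pr, forall w, exists b, pattern_at (b * m) m (sample_path X w)}.
Proof.
exists (\bigcap_b (sample_path X @^-1` no_pattern b)); split.
- apply: bigcapT_measurable => b.
  exact: (measurable_path_preimage (@measurable_no_pattern b)).
- set N := \bigcap_b _; have mN : measurable N.
    apply: bigcapT_measurable => b.
    exact: (measurable_path_preimage (@measurable_no_pattern b)).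
  have [p0 p1] := andP p01.
  have fp : p \is a fin_num.
    by rewrite ge0_fin_numE ?(ltW p0)// (le_lt_trans p1)// ltry.
  have z01 : 0 <= 1 - fine p < 1.
    rewrite subr_ge0 ltrBlDr ltrDl; apply/andP; split.
      by rewrite -lee_fin fineK.
    by rewrite fine_gt0// p0 (le_lt_trans p1)// ltry.
  have PN b : fine (Pr N) <= (1 - fine p) ^+ b.
    rewrite -lee_fin fineK ?fin_num_measure// -prob_no_pattern.
    apply: le_measure; rewrite ?inE//; last by move=> w; exact.
    exact: (measurable_path_preimage (@measurable_no_pattern b)).
  apply/eqP; rewrite -measure_le0 leNgt; apply/negP => PN0.
  have r0 : 0 < fine (Pr N).
    by rewrite fine_gt0// PN0 (le_lt_trans (probability_le1 _ _))// ltry.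
  have /cvgr0Pnorm_lt/(_ _ r0)[b _ /(_ b (leqnn b))] :
      (1 - fine p) ^+ b @[b --> \oo] --> (0 : R).
    by apply: cvg_expr; have /andP[z0 z1] := z01; rewrite ger0_norm.
  rewrite /= ger0_norm ?exprn_ge0//; last by have /andP[] := z01.
  by move/(le_lt_trans (PN b)); rewrite ltxx.
- move=> w /= /forallNP nw b _ c cb; exact: nw.
Qed.

End Patterns.

(** * The law of the whole interarrival sequence *)

Section Law.
Variables (R : realType) (lam : R).
Variables (d d' : measure_display).
Variables (Omega : measurableType d) (Omega' : measurableType d').
Variables (Pr : probability Omega R) (Pr' : probability Omega' R).
Variables (X : nat -> {RV Pr >-> R}) (X' : nat -> {RV Pr' >-> R}).
Hypotheses (XP : poisson_interarrivals lam X).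
Hypotheses (XP' : poisson_interarrivals lam X').

Lemma distribution_path_unique (A : set (path_space R)) : measurable A ->
  Pr (sample_path X @^-1` A) = Pr' (sample_path X' @^-1` A).
Proof.
move=> mA.
change (distribution Pr (full_path X) A = distribution Pr' (full_path X') A).
apply: (@measure_unique _ _ (path_space R) (@finite_cylinder R)
  (fun=> setT)) => //.
- exact: finite_cylinder_setI.
- by move=> _; exists 0%N => //; exact: cylinderT.
- by rewrite bigcup_const//; exists 0%N.
- move=> B [n _ [C [mC TC ->]]].
  rewrite [LHS](prob_cylinder (proj1 XP) mC TC).
  rewrite [RHS](prob_cylinder (proj1 XP') mC TC).
  apply: eq_bigr => i _; rewrite -[LHS]/(distribution Pr (X i) (C i)).
  by rewrite (proj2 XP)// -[RHS]/(distribution Pr' (X' i) (C i)) (proj2 XP').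
- by move=> _; rewrite /= probability_setT ltry.
Qed.

End Law.

(** * Deterministic dynamics *)

Section Trajectory.
Variables (R : realType) (r q : nat) (tau : R).
Hypotheses (hq : (0 < q)%N) (tau0 : 0 < tau).
Implicit Types (s : state R) (x : nat -> R).

(** Includes the origin: [clock x 0 = 0], and [clock x k.+1] is [arrival x k]. Hence
    [after_arrivals] with index [k] is the state just after epoch [clock x k]. *)
Definition clock x (k : nat) : R := \sum_(i < k) x i.

Definition in_range s := (r < position q s <= r + q)%N.

Definition next_position (p : nat) : nat := if p.-1 == r then (r + q)%N else p.-1.

Definition empty_position : nat := (q * ((r + q) %/ q))%N.

Lemma position_deliver t s : position q (deliver q t s) = position q s.
Proof.
rewrite /position /on_order /= -addnA -mulnDr size_filter; congr (_ + _ * _)%N.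
rewrite -(count_predC (fun e => e <= t) (due s)); congr (_ + _)%N.
by apply: eq_count => e /=; rewrite ltNge.
Qed.

Lemma position_demand t s : position q (demand r q tau t s) =
  if (0 < on_hand s)%N then next_position (position q s) else position q s.
Proof.
case: s => -[|l] D //; rewrite /demand /replenish /next_position /on_hand ltn0Sn.
rewrite -[X in X == r]/(position q (State l D)).
rewrite -[(position q (State l.+1 D)).-1]/(position q (State l D)).
case: eqP => // lr; rewrite -lr.
by rewrite /position /on_order /= size_rcons mulnS addnCA addnC.
Qed.

Lemma on_hand_demand t s : on_hand (demand r q tau t s) = (on_hand s).-1.
Proof.
by case: s => -[|l] D //; rewrite /demand /replenish /=; case: ifP.
Qed.

Lemma due_demand t s : {subset due (demand r q tau t s) <= t + tau :: due s}.
Proof.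
case: s => -[|l] D e; rewrite /demand /=; first by rewrite inE orbC => ->.
rewrite /replenish; case: ifP => _ /=; last by rewrite inE orbC => ->.
by rewrite mem_rcons.
Qed.

Lemma in_range_deliver t s : in_range (deliver q t s) = in_range s.
Proof. by rewrite /in_range position_deliver. Qed.

Lemma in_range_demand t s : in_range s -> in_range (demand r q tau t s).
Proof.
rewrite /in_range position_demand; case: ifP => // _.
by rewrite /next_position; case: eqP; lia.
Qed.

(** Without stock the position is [q] times the number of outstanding orders, and exactly one
    multiple of [q] lies in the [q] consecutive integers from [r + 1] to [r + q]. *)
Lemma in_range_empty s : in_range s -> on_hand s = 0%N ->
  position q s = empty_position.
Proof.
rewrite /in_range /position /on_order => + s0; rewrite s0 add0n => /andP[h1 h2].
congr (q * _)%N; apply/eqP; rewrite eqn_leq leq_divRL// mulnC h2/=.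
by rewrite -ltnS ltn_divLR// mulSnr mulnC ltn_add2r.
Qed.

Lemma foldr_min_le (t z : R) (l : seq R) :
  (foldr Num.min z l <= t) = (z <= t) || has (fun e => e <= t) l.
Proof. by elim: l => [|e l IHl] /=; rewrite ?orbF// ge_min IHl orbCA. Qed.

Lemma le_foldr_min (t z : R) (l : seq R) :
  (t <= foldr Num.min z l) = (t <= z) && all (fun e => t <= e) l.
Proof. by elim: l => [|e l IHl] /=; rewrite ?andbT// le_min IHl andbCA. Qed.

(* First epoch from [a] on at which there is stock, if no customer arrives. *)
Definition stock_epoch (a : R) s : R :=
  if on_hand s == 0%N then foldr Num.min (a + tau) (due s) else a.

Lemma in_stock_deliver a t s : in_range s ->
  {in due s, forall e, a < e <= a + tau} -> a <= t ->
  (0 < on_hand (deliver q t s))%N = (stock_epoch a s <= t).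
Proof.
move=> sP dueP at_; rewrite /stock_epoch /deliver /=; case: eqP => [s0|/eqP s0].
  (* The default [a + tau] of the minimum never decides: an empty stock with position above [r]
     forces an outstanding order, and that order is due by [a + tau]. *)
  rewrite s0 add0n muln_gt0 hq/= -has_count foldr_min_le orb_idl// => zt.
  have: (0 < size (due s))%N.
    move: sP; rewrite /in_range /position /on_order s0.
    by case: (due s) => //=; rewrite muln0 ltn0.
  case: (due s) dueP => //= e D /(_ e); rewrite mem_head => /(_ isT)/andP[_ eD] _.
  by rewrite (le_trans eD zt).
by rewrite at_ addn_gt0 lt0n s0.
Qed.

Definition residual (a : R) s : R := \sum_(e <- due s) (e - a).

(** A served customer lowers the position by one, which adds [tau]. If an order is placed as well,
    [q] times the residual gains [q * tau] and [tau] times the position gains the same, so the net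
    gain is still [tau]. *)
Lemma residual_demand t s :
  q%:R * residual t (demand r q tau t s) -
    tau * (position q (demand r q tau t s))%:R =
  q%:R * residual t s - tau * (position q s)%:R +
    tau * (0 < on_hand s)%N%:R.
Proof.
case: s => -[|l] D; first by rewrite /demand /= mulr0 addr0.
have -> : position q (State l.+1 D) = (position q (State l D)).+1 by [].
rewrite /demand /replenish /=; case: ifP => _; last first.
  by rewrite /residual /= -natr1; ring.
rewrite /residual /= big_rcons /=.
have -> : position q (State l (rcons D (t + tau))) = (position q (State l D) + q)%N.
  by rewrite /position /on_order /= size_rcons; lia.
by rewrite natrD -natr1; ring.
Qed.

Definition cycle_mean : R := r%:R + (q%:R + 1) / 2.

(* Discrete primitive of [p - cycle_mean] along the cyclic decrements of the
   inventory position. *)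
Definition position_potential (p : nat) : R :=
  (r%:R + q%:R / 2) * p%:R - p%:R ^+ 2 / 2.

(** The wrap from [r + 1] to [r + q] is consistent because [cycle_mean] is the mean of the positions
    in a cycle, so the increments sum to zero over it. *)
Lemma position_potential_next p : (r < p <= r + q)%N ->
  position_potential (next_position p) =
  position_potential p + p%:R - cycle_mean.
Proof.
case: p => // p /andP[rp prq]; rewrite /next_position /position_potential /=.
rewrite /cycle_mean -natr1; case: eqP => [->|_]; last by field.
by rewrite natrD; field.
Qed.

Section Path.
Variables (s0 : state R) (x : nat -> R).
Hypothesis s0P : admissible r q tau s0.

Notation after k := (after_arrivals r q tau s0 x k).

(* Time from the [k]-th arrival until the system is next in stock, ignoring
   later arrivals. *)
Definition wait (k : nat) : R :=
  Num.max 0 (stock_epoch (clock x k) (after k) - clock x k).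

Lemma in_range_after k : in_range (after k).
Proof.
elim: k => [|k IHk]; first exact: (proj1 s0P).
by apply: in_range_demand; rewrite in_range_deliver.
Qed.

Hypothesis x0 : forall i, 0 < x i.

Lemma clockS k : clock x k.+1 = clock x k + x k.
Proof. exact: big_ord_recr. Qed.

Lemma clock_lt : {homo clock x : j k / (j < k)%N >-> j < k}.
Proof. by apply: homo_ltn lt_trans _ => k; rewrite clockS ltrDl. Qed.

Lemma clock_le : {homo clock x : j k / (j <= k)%N >-> j <= k}.
Proof. by apply: homo_leq le_trans _ => // k; rewrite clockS lerDl ltW. Qed.

Lemma clock0 : clock x 0 = 0.
Proof. exact: big_ord0. Qed.

Lemma clock_ge0 k : 0 <= clock x k.
Proof. by rewrite -clock0 clock_le. Qed.

Lemma due_after k : {in due (after k), forall e, clock x k < e <= clock x k + tau}.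
Proof.
elim: k => [|k IHk] e /=.
  by rewrite /clock big_ord0 add0r => /(proj2 s0P).
move/due_demand; rewrite inE => /predU1P[->|].
  by rewrite lexx andbT ltrDl.
rewrite /= mem_filter => /andP[ke /IHk/andP[_ ek]].
rewrite [arrival _ _]/(clock x k.+1) in ke *.
by rewrite ke (le_trans ek)// lerD2r clock_le.
Qed.

Lemma stock_epoch_ge k :
  clock x k <= stock_epoch (clock x k) (after k) <= clock x k + tau.
Proof.
rewrite /stock_epoch; case: ifP => _; last by rewrite lexx lerDl ltW.
rewrite foldr_min_le lexx andbT le_foldr_min lerDl (ltW tau0)/=.
by apply/allP => e /due_after/andP[/ltW].
Qed.

Lemma waitE k : wait k = stock_epoch (clock x k) (after k) - clock x k.
Proof. by rewrite /wait max_r// subr_ge0; case/andP: (stock_epoch_ge k). Qed.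

(** Puts the service of the next customer in the form required by [compensated]: a threshold test on
    [x k] whose level [wait k] is known at epoch [clock x k]. *)
Lemma in_stock_arrival k :
  (0 < on_hand (deliver q (clock x k.+1) (after k)))%N = (wait k <= x k).
Proof.
rewrite (@in_stock_deliver (clock x k))//; last 3 first.
- exact: in_range_after.
- exact: due_after.
- exact: clock_le.
by rewrite waitE clockS lerBlDl.
Qed.

Lemma position_after k : position q (after k.+1) =
  if wait k <= x k then next_position (position q (after k))
  else position q (after k).
Proof.
rewrite [LHS]position_demand [arrival _ _]/(clock x k.+1) in_stock_arrival.
by rewrite position_deliver.
Qed.

Definition served (n : nat) : R := \sum_(k < n) (wait k <= x k)%R%:R.

Lemma sum_served_position n :
  \sum_(k < n) (position q (after k))%:R * (wait k <= x k)%R%:R =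
  cycle_mean * served n + position_potential (position q (after n)) -
  position_potential (position q s0).
Proof.
elim: n => [|n IHn]; first by rewrite /served !big_ord0 mulr0 add0r subrr.
rewrite /served !big_ord_recr IHn/= -/(served n) position_after.
have := position_potential_next (in_range_after n).
case: (wait n <= x n) => [->|_] /=; ring.
Qed.

(** The common factor is the stockout time in the interval. If there is stock after the [k]-th
    arrival, [wait k] is zero and the factor vanishes; otherwise the position is
    [empty_position]. *)
Lemma position_unavailable k :
  (position q (after k))%:R * (x k - Num.max 0 (x k - wait k)) =
  empty_position%:R * (x k - Num.max 0 (x k - wait k)) :> R.
Proof.
have [s0_|s0_] := eqVneq (on_hand (after k)) 0%N.
  by rewrite (in_range_empty (in_range_after k)).
rewrite waitE /stock_epoch (negbTE s0_) subrr subr0 max_r ?subrr ?mulr0//.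
exact: ltW.
Qed.

Lemma on_order_balance k :
  q%:R * \sum_(e <- due (after k)) (Num.min e (clock x k.+1) - clock x k) =
  q%:R * residual (clock x k) (after k) - tau * (position q (after k))%:R -
  (q%:R * residual (clock x k.+1) (after k.+1) -
     tau * (position q (after k.+1))%:R) + tau * (wait k <= x k)%R%:R.
Proof.
rewrite [after k.+1]/= [arrival _ _]/(clock x k.+1) residual_demand.
rewrite position_deliver in_stock_arrival.
(* The time each order stays outstanding within the interval is exactly the drop of its residual
   lead time. *)
suff -> : \sum_(e <- due (after k)) (Num.min e (clock x k.+1) - clock x k) =
    residual (clock x k) (after k) -
    residual (clock x k.+1) (deliver q (clock x k.+1) (after k)) by ring.
rewrite /residual /= big_filter [X in _ - X]big_mkcond -sumrB.
apply: eq_bigr => e _; case: ltP => _; last by rewrite subr0.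
by ring.
Qed.

End Path.

End Trajectory.

(** * Integrals over the intervals between arrivals *)

Section StepIntegrals.
Variable R : realType.
Notation mu := (@lebesgue_measure R).
Implicit Types (f g : R -> R) (a b c u v : R).

(** Half-open intervals match the right-continuous states and concatenate without overlap.
    Integrability is bundled in because additivity of the real-valued integral requires it. *)
Definition has_integral f a b v :=
  mu.-integrable setT (EFin \o (f \_ `[a, b[)) /\
  \int[mu]_t (f \_ `[a, b[) t = v.

Lemma has_integral_Rintegral f a b v : has_integral f a b v ->
  \int[mu]_(t in `[a, b]) f t = v.
Proof.
move=> [fi <-]; rewrite -Rintegral_itv_bndo_bndc; first exact: Rintegral_mkcond.
have : mu.-integrable setT ((EFin \o f) \_ `[a, b[) by rewrite restrict_EFin.
by move/integrable_restrict; rewrite setTI; exact.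
Qed.

Lemma eq_has_integral f g a b v : (forall t, a <= t < b -> f t = g t) ->
  has_integral f a b v -> has_integral g a b v.
Proof.
move=> fg; rewrite /has_integral (_ : g \_ `[a, b[ = f \_ `[a, b[)//.
apply/funext => t; rewrite !patchE; case: ifPn => //.
by rewrite inE/= in_itv/= => /fg.
Qed.

Lemma has_integralD f g a b u v : has_integral f a b u ->
  has_integral g a b v -> has_integral (fun t => f t + g t) a b (u + v).
Proof.
move=> [fi <-] [gi <-]; rewrite /has_integral.
have -> : (fun t => f t + g t) \_ `[a, b[ =
    fun t => (f \_ `[a, b[) t + (g \_ `[a, b[) t.
  by apply/funext => t; rewrite !patchE; case: ifP => _; rewrite ?addr0.
split; last by rewrite RintegralD.
by apply: eq_integrable (integrableD _ fi gi) => // t _; rewrite /= EFinD.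
Qed.

Lemma has_integralZ k f a b v : has_integral f a b v ->
  has_integral (fun t => k * f t) a b (k * v).
Proof.
move=> [fi <-]; rewrite /has_integral.
have -> : (fun t => k * f t) \_ `[a, b[ = fun t => k * (f \_ `[a, b[) t.
  by apply/funext => t; rewrite !patchE; case: ifP => _; rewrite ?mulr0.
split; last by rewrite RintegralZl.
by apply: eq_integrable (integrableZl _ k fi) => // t _; rewrite /= EFinM.
Qed.

Lemma has_integral_cst a b k : a <= b ->
  has_integral (fun=> k) a b (k * (b - a)).
Proof.
move=> ab; apply: (@eq_has_integral (fun t => k * 1)); first by rewrite mulr1.
apply: has_integralZ; rewrite /has_integral.
have -> : (fun=> 1 : R) \_ `[a, b[ = \1_`[a, b[.
  by apply/funext => t; rewrite patchE indicE; case: ifP.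
split; first exact: integrable_indic_itv.
rewrite /Rintegral integral_indic// setIT/= lebesgue_measure_itv/= lte_fin.
by case: ltgtP ab => // ->; rewrite subrr.
Qed.

Lemma has_integral_lt a b e : a <= b -> a <= e ->
  has_integral (fun t => (t < e)%R%:R) a b (Num.min e b - a).
Proof.
move=> ab ae; rewrite /has_integral.
have -> : (fun t => (t < e)%R%:R : R) \_ `[a, b[ =
    (fun=> 1 : R) \_ `[a, Num.min e b[.
  apply/funext => t; rewrite !patchE !mem_setE !in_itv/= lt_min.
  by case: (a <= t) (t < e) (t < b) => [] [] [].
rewrite -[_ - a]mul1r; apply: has_integral_cst.
by rewrite le_min ae.
Qed.

Lemma has_integral_cat f a b c u v : a <= b -> b <= c ->
  has_integral f a b u -> has_integral f b c v -> has_integral f a c (u + v).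
Proof.
move=> ab bc [fi <-] [gi <-]; rewrite /has_integral.
have -> : f \_ `[a, c[ = fun t => (f \_ `[a, b[) t + (f \_ `[b, c[) t.
  apply/funext => t; rewrite !patchE !mem_setE !in_itv/=.
  have [tb|bt] := ltP t b; first by rewrite (lt_le_trans tb bc) andbT addr0.
  by rewrite (le_trans ab bt) andbF/= add0r.
split; last by rewrite RintegralD.
by apply: eq_integrable (integrableD _ fi gi) => // t _; rewrite /= EFinD.
Qed.

Lemma has_integral0 f a : has_integral f a a 0.
Proof.
apply: (@eq_has_integral (fun=> 0)) => [t /andP[]|].
  by move=> /le_lt_trans/[apply]; rewrite ltxx.
by have := has_integral_cst 0 (lexx a); rewrite mul0r.
Qed.

Lemma has_integral_sum (I : eqType) (s : seq I) (f : I -> R -> R)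
    (v : I -> R) a b :
  a <= b -> (forall i, i \in s -> has_integral (f i) a b (v i)) ->
  has_integral (fun t => \sum_(i <- s) f i t) a b (\sum_(i <- s) v i).
Proof.
move=> ab; elim: s => [_|i s IHs fv].
  rewrite big_nil; apply: (@eq_has_integral (fun=> 0)).
    by move=> t _; rewrite big_nil.
  by have := has_integral_cst 0 ab; rewrite mul0r.
have fs : has_integral (fun t => \sum_(i <- s) f i t) a b (\sum_(i <- s) v i).
  by apply: IHs => j js; apply: fv; rewrite inE js orbT.
have fi := fv i (mem_head _ _).
rewrite big_cons; apply: eq_has_integral (has_integralD fi fs) => t _.
by rewrite big_cons.
Qed.

End StepIntegrals.

Section PathIntegrals.
Variables (R : realType) (r q : nat) (tau : R).
Hypotheses (hq : (0 < q)%N) (tau0 : 0 < tau).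
Variables (s0 : state R) (x : nat -> R).
Hypotheses (s0P : admissible r q tau s0) (x0 : forall i, 0 < x i).

Notation after k := (after_arrivals r q tau s0 x k).
Notation clock := (clock x).
Notation wait := (wait r q tau s0 x).

Lemma arrival_countE k t : clock k <= t < clock k.+1 -> arrival_count x t = k.
Proof.
move=> /andP[kt tk]; rewrite /arrival_count (_ : [set n | _] = `I_k).
  by apply: card_fset_set; exact: card_eqxx.
apply/seteqP; split=> n /=.
  change (clock n.+1 <= t -> (n < k)%N) => nt; rewrite ltnNge; apply/negP => kn.
  have := le_trans (clock_le x0 (kn : (k.+1 <= n.+1)%N)) nt.
  by rewrite leNgt tk.
by move=> nk; apply: le_trans kt; exact: (clock_le x0 nk).
Qed.

Lemma has_integral_state (F : state R -> R) (v : nat -> R) n :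
  (forall k, has_integral (fun t => F (deliver q t (after k)))
     (clock k) (clock k.+1) (v k)) ->
  has_integral (fun t => F (state_at r q tau s0 x t)) 0 (clock n)
    (\sum_(k < n) v k).
Proof.
move=> Fv; elim: n => [|n IHn].
  by rewrite big_ord0 clock0; exact: has_integral0.
rewrite big_ord_recr/=; apply: has_integral_cat IHn _.
- exact: clock_ge0.
- exact: (clock_le x0 (leqnSn n)).
- apply: eq_has_integral (Fv n) => t tn.
  by rewrite /state_at (arrival_countE tn).
Qed.

Lemma position_integral k :
  has_integral (fun t => (position q (deliver q t (after k)))%:R)
    (clock k) (clock k.+1) ((position q (after k))%:R * x k).
Proof.
rewrite -[x k](addKr (clock k)) -clockS addrC.
apply: eq_has_integral (has_integral_cst _ (clock_le x0 (leqnSn k))) => t _.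
by rewrite position_deliver.
Qed.

Lemma on_order_integral k :
  has_integral (fun t => (on_order q (deliver q t (after k)))%:R)
    (clock k) (clock k.+1)
    (q%:R * \sum_(e <- due (after k)) (Num.min e (clock k.+1) - clock k)).
Proof.
have kS := clock_le x0 (leqnSn k).
apply: (@eq_has_integral _
  (fun t => q%:R * \sum_(e <- due (after k)) (t < e)%R%:R)).
  move=> t _; rewrite /on_order /= natrM size_filter -sum1_count natr_sum.
  by congr (_ * _); rewrite [RHS]big_mkcond; apply: eq_bigr => e _; case: ifP.
apply/has_integralZ/has_integral_sum => // e ek; apply: has_integral_lt => //.
by have /andP[/ltW] := due_after tau0 s0P x0 ek.
Qed.

Lemma on_hand_integral k :
  has_integral (fun t => (on_hand (deliver q t (after k)))%:R)
    (clock k) (clock k.+1) ((position q (after k))%:R * x k -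
    q%:R * \sum_(e <- due (after k)) (Num.min e (clock k.+1) - clock k)).
Proof.
rewrite -mulN1r.
have := has_integralD (position_integral k)
  (has_integralZ (-1) (on_order_integral k)).
by apply: eq_has_integral => t _; rewrite /position natrD mulN1r addrK.
Qed.

Lemma stockout_integral k :
  has_integral (fun t => (on_hand (deliver q t (after k)) == 0%N)%:R)
    (clock k) (clock k.+1) (x k - Num.max 0 (x k - wait k)).
Proof.
have kS := clock_le x0 (leqnSn k).
have /andP[ae _] := stock_epoch_ge tau0 s0P x0 k.
(* A stockout within the interval lasts from its left end until the stock epoch or the next arrival,
   whichever comes first. *)
have -> : x k - Num.max 0 (x k - wait k) =
    Num.min (stock_epoch tau (clock k) (after k)) (clock k.+1) - clock k.
  rewrite (waitE tau0 s0P x0) clockS.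
  by rewrite maxEle minEle; case: ifP => h1; case: ifP => h2; lra.
apply: eq_has_integral (has_integral_lt kS ae) => t /andP[kt _].
rewrite -[_ == _]negbK -lt0n.
rewrite (@in_stock_deliver _ r q tau hq (clock k))//; last 2 first.
- exact: in_range_after.
- exact: due_after.
by rewrite ltNge.
Qed.

End PathIntegrals.

(** * Forgetting the initial state *)

Section Coupling.
Variables (R : realType) (r q : nat) (tau : R).
Hypotheses (hq : (0 < q)%N) (tau0 : 0 < tau).

(* A long gap lets all orders arrive; [r + q] quick arrivals then exhaust the
   stock before anything is delivered; after a second long gap the stock is
   [empty_position r q], whatever the initial state was. *)
Definition forgetting_gap (i : nat) : set R :=
  if (i == 0%N) || (i == r + q)%N then [set` `[tau + 1, +oo[]
  else [set` `[0, tau / (r + q)%:R]].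

Lemma measurable_forgetting_gap i : measurable (forgetting_gap i).
Proof. by rewrite /forgetting_gap; case: ifP. Qed.

Lemma forgetting_gap_gt0 (lam : R) i : 0 < lam ->
  (0 < exponential_prob lam (forgetting_gap i))%E.
Proof.
move=> lam0; rewrite /forgetting_gap; case: ifP => _.
  by rewrite exponential_prob_itvcy ?addr_ge0 ?(ltW tau0)// lte_fin expR_gt0.
have c0 : 0 < tau / (r + q)%:R by rewrite divr_gt0// ltr0n addn_gt0 hq orbT.
rewrite exponential_prob_itv0c// -EFinB lte_fin subr_gt0 expR_lt1.
by rewrite mulNr oppr_lt0 mulr_gt0.
Qed.

Section Path.
Variables (s0 : state R) (x : nat -> R) (n : nat).
Hypotheses (s0P : admissible r q tau s0) (x0 : forall i, 0 < x i).
Hypothesis xn : pattern_at forgetting_gap n (r + q).+1 x.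

Notation after k := (after_arrivals r q tau s0 x k).

Let long_gap i : (i == 0%N) || (i == r + q)%N -> tau < x (n + i)%N.
Proof.
move=> i0; have : (i < (r + q).+1)%N by lia.
move/xn; rewrite /forgetting_gap i0 /= in_itv/= andbT.
by apply: lt_le_trans; rewrite ltrDl.
Qed.

Let after_long_gap k : tau < x k ->
  deliver q (clock x k.+1) (after k) = State (position q (after k)) [::].
Proof.
move=> xk; have dueP := due_after tau0 s0P x0 (k := k).
have late e : e \in due (after k) -> e <= clock x k.+1.
  move=> /dueP/andP[_ /le_trans]; apply.
  by rewrite clockS lerD2l ltW.
rewrite /deliver /position /on_order; congr State.
  by congr (_ + q * _)%N; apply/eqP; rewrite -all_count; apply/allP.
apply/size0nil/eqP; rewrite size_filter -leqn0 leqNgt -has_count.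
by apply/hasPn => e /late; rewrite leNgt.
Qed.

(** The first long gap clears all orders, leaving at most [r + q] units on hand. The following
    arrivals all occur less than [tau] after the end of that gap, before any newer order is
    delivered, so each takes one unit until none is left. *)
Let depleted j : (0 < j <= r + q)%N ->
  (on_hand (after (n + j)) <= r + q - j)%N /\
  {in due (after (n + j)), forall e, clock x n.+1 + tau <= e}.
Proof.
elim: j => [//|[_ _|j IHj jrq]].
  have xn0 : tau < x n by rewrite -[n]addn0; exact: long_gap.
  rewrite addn1 [after n.+1]/= [arrival _ _]/(clock x n.+1) after_long_gap//.
  split; last first.
    by move=> e /due_demand; rewrite inE => /eqP ->; exact: lexx.
  rewrite on_hand_demand /=.
  by have := in_range_after hq tau0 x s0P n; rewrite /in_range; lia.
have [IH1 IH2] : (on_hand (after (n + j.+1)) <= r + q - j.+1)%N /\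
    {in due (after (n + j.+1)), forall e, clock x n.+1 + tau <= e}.
  by apply: IHj; lia.
have early : clock x (n + j.+2) < clock x n.+1 + tau.
  have -> : (n + j.+2 = n.+1 + j.+1)%N by lia.
  (* Fewer than [r + q] short gaps, each at most [tau / (r + q)], add up to less than [tau]. *)
  have : clock x (n.+1 + j.+1) <= clock x n.+1 + j.+1%:R * (tau / (r + q)%:R).
    have : (j.+1 < r + q)%N by lia.
    elim: j.+1 => [_|i IHi irq]; first by rewrite addn0 mul0r addr0.
    rewrite addnS clockS -natr1 mulrDl mul1r addrA lerD//; first by apply: IHi; lia.
    have : (i.+1 < (r + q).+1)%N by lia.
    rewrite addSnnS => /xn; rewrite /forgetting_gap ifF; last by lia.
    by rewrite /= in_itv/= => /andP[].
  move=> /le_lt_trans; apply; rewrite ltrD2l mulrCA gtr_pMr//.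
  by rewrite ltr_pdivrMr ?ltr0n ?mul1r ?ltr_nat; lia.
have -> : (n + j.+2 = (n + j.+1).+1)%N by lia.
rewrite [after _.+1]/= [arrival _ _]/(clock x (n + j.+1).+1).
have early' : clock x (n + j.+1).+1 < clock x n.+1 + tau.
  by rewrite -addnS.
split; last first.
  move=> e /due_demand; rewrite inE => /predU1P[->|].
    by rewrite lerD2r (clock_le x0)//; lia.
  by rewrite /= mem_filter => /andP[_ /IH2].
rewrite on_hand_demand /= (_ : count _ _ = 0)%N; first by lia.
apply/eqP; rewrite -leqn0 leqNgt -has_count; apply/hasPn => e /IH2 ne.
by rewrite -ltNge (lt_le_trans early').
Qed.

Lemma forgetting_after : after (n + (r + q).+1) =
  demand r q tau (clock x (n + (r + q).+1)) (State (empty_position r q) [::]).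
Proof.
have rq0 : (0 < r + q)%N by lia.
have [oh _] : (on_hand (after (n + (r + q))) <= r + q - (r + q))%N /\
    {in due (after (n + (r + q))), forall e, clock x n.+1 + tau <= e}.
  by apply: depleted; lia.
rewrite addnS [LHS]/= [arrival _ _]/(clock x (n + (r + q)).+1).
rewrite after_long_gap ?long_gap ?eqxx ?orbT//; congr (demand _ _ _ _ (State _ _)).
apply: in_range_empty => //; first exact: in_range_after.
by apply/eqP; rewrite -leqn0 (leq_trans oh)// subnn.
Qed.

End Path.

(** By [forgetting_after], the state at the end of the pattern depends only on the epoch; from there
    both systems follow the same recursion. *)
Lemma after_coupled (s s' : state R) (x : nat -> R) n k :
  admissible r q tau s -> admissible r q tau s' -> (forall i, 0 < x i) ->
  pattern_at forgetting_gap n (r + q).+1 x -> (n + (r + q).+1 <= k)%N ->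
  after_arrivals r q tau s x k = after_arrivals r q tau s' x k.
Proof.
move=> sP s'P x0 xn /subnK <-; elim: (k - _)%N => [|i IHi].
  by rewrite add0n !(forgetting_after _ x0 xn).
by rewrite addSn /= IHi.
Qed.

End Coupling.

(** * Measurability of the states *)

Section MeasurableStates.
Variables (R : realType) (d : measure_display) (T : measurableType d).
Implicit Types (f : T -> R) (L : T -> seq R) (S : T -> state R).

(** States carry no sigma-algebra; measurability is encoded by shape instead. These are lists of
    constant length with measurable entries. *)
Inductive measurable_seq : (T -> seq R) -> Prop :=
| measurable_nil : measurable_seq (fun=> [::])
| measurable_cons f L : measurable_fun setT f -> measurable_seq L ->
    measurable_seq (fun w => f w :: L w).

(** A finite decision tree with measurable tests, each leaf having constant stock and a constant
    number of outstanding orders. *)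
Inductive measurable_state : (T -> state R) -> Prop :=
| measurable_const_state l L : measurable_seq L ->
    measurable_state (fun w => State l (L w))
| measurable_if_state (b : T -> bool) S S' : measurable_fun setT b ->
    measurable_state S -> measurable_state S' ->
    measurable_state (fun w => if b w then S w else S' w).

Lemma measurable_seq_size L : measurable_seq L -> exists n, forall w, size (L w) = n.
Proof.
elim=> [|f {}L _ _ [n Ln]]; first by exists 0%N.
by exists n.+1 => w /=; rewrite Ln.
Qed.

Lemma measurable_rcons f L : measurable_fun setT f -> measurable_seq L ->
  measurable_seq (fun w => rcons (L w) (f w)).
Proof.
move=> mf; elim=> [|g {}L mg _ IHL] /=; last exact: measurable_cons.
exact: (measurable_cons mf measurable_nil).
Qed.

Lemma measurable_state_map (F : T -> state R -> state R) S :
  (forall l L, measurable_seq L ->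
     measurable_state (fun w => F w (State l (L w)))) ->
  measurable_state S -> measurable_state (fun w => F w (S w)).
Proof.
move=> mF; elim=> [l L mL|b {}S S' mb _ IH _ IH']; first exact: mF.
rewrite (_ : (fun _ => _) = fun w => if b w then F w (S w) else F w (S' w)).
  exact: measurable_if_state.
by apply/funext => w; case: ifP.
Qed.

Lemma measurable_state_fun (F : T -> state R -> R) S :
  (forall l L, measurable_seq L ->
     measurable_fun setT (fun w => F w (State l (L w)))) ->
  measurable_state S -> measurable_fun setT (fun w => F w (S w)).
Proof.
move=> mF; elim=> [l L mL|b {}S S' mb _ IH _ IH']; first exact: mF.
rewrite (_ : (fun _ => _) = fun w => if b w then F w (S w) else F w (S' w)).
  exact: measurable_fun_ifT.
by apply/funext => w; case: ifP.
Qed.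

Variables (r q : nat) (tau : R).

Lemma measurable_lt_fun f g : measurable_fun setT f -> measurable_fun setT g ->
  measurable_fun setT (fun w => f w < g w).
Proof. by move=> mf mg; exact: measurable_fun_ltr. Qed.

Lemma measurable_deliver f S : measurable_fun setT f -> measurable_state S ->
  measurable_state (fun w => deliver q (f w) (S w)).
Proof.
move=> mf; apply: (measurable_state_map (F := fun w => deliver q (f w))) => l L mL.
rewrite /deliver /=; elim: mL l => [|g {}L mg mL IHL] l.
  by rewrite /= muln0 addn0; exact/measurable_const_state/measurable_nil.
(* Branch on whether the first order is still pending. If it is delivered, the constant stock
   becomes [l + q], hence the induction with [l] general. *)
rewrite (_ : (fun _ => _) = fun w => if f w < g w then
    State (l + q * count (fun e => e <= f w) (L w))
      (g w :: [seq e <- L w | f w < e])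
  else State (l + q + q * count (fun e => e <= f w) (L w))
      [seq e <- L w | f w < e]); last first.
  apply/funext => w /=; rewrite leNgt; case: ifP => _ /=; first by rewrite add0n.
  by rewrite mulnS addnA.
apply: measurable_if_state; [exact: measurable_lt_fun| |exact: IHL].
apply: (@measurable_state_map (fun w s => State (on_hand s) (g w :: due s))
  _ _ (IHL l)) => l' L' mL'.
exact/measurable_const_state/measurable_cons.
Qed.

Lemma measurable_demand f S : measurable_fun setT f -> measurable_state S ->
  measurable_state (fun w => demand r q tau (f w) (S w)).
Proof.
move=> mf; apply: (measurable_state_map (F := fun w => demand r q tau (f w))).
move=> [|l] L mL; rewrite /demand /=; first exact: measurable_const_state.
have [n Ln] := measurable_seq_size mL.
rewrite /replenish /position /on_order /=.
rewrite (_ : (fun _ => _) = fun w => if (l + q * n == r)%N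
    then State l (rcons (L w) (f w + tau)) else State l (L w)); last first.
  by apply/funext => w; rewrite Ln.
case: (l + q * n == r)%N; last exact: measurable_const_state.
by apply/measurable_const_state/measurable_rcons => //; exact: measurable_funD.
Qed.

Variables (s0 : state R) (x : T -> nat -> R) (n : nat).
Hypothesis mx : forall i, (i < n)%N -> measurable_fun setT (x ^~ i).

Lemma measurable_clock k : (k <= n)%N ->
  measurable_fun setT (fun w => clock (x w) k).
Proof.
move=> kn; apply: measurable_sum => i; apply: mx; exact: leq_trans kn.
Qed.

Lemma measurable_after k : (k <= n)%N ->
  measurable_state (fun w => after_arrivals r q tau s0 (x w) k).
Proof.
elim: k => [_|k IHk kn] /=.
  case: s0 => l D; apply: measurable_const_state.
  by elim: D => [|e D IHD]; [exact: measurable_nil|exact: measurable_cons].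
have mk : measurable_fun setT (fun w => arrival (x w) k).
  exact: (measurable_clock kn).
by apply: measurable_demand => //; apply: measurable_deliver => //;
  apply: IHk; exact: ltnW.
Qed.

Lemma measurable_wait k : (k <= n)%N ->
  measurable_fun setT (fun w => wait r q tau s0 (x w) k).
Proof.
move=> kn; have mk := measurable_clock kn.
apply: measurable_maxr => //; apply: measurable_funB => //.
apply: (@measurable_state_fun (fun w => stock_epoch tau (clock (x w) k))
  _ _ (measurable_after kn)) => l L mL.
rewrite /stock_epoch /=; case: (l == 0%N) => //.
elim: mL => [|f {}L mf _ IHL] /=; first exact: measurable_funD.
exact: measurable_minr.
Qed.

Lemma measurable_position k : (k <= n)%N ->
  measurable_fun setT
    (fun w => (position q (after_arrivals r q tau s0 (x w) k))%:R : R).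
Proof.
move=> kn.
apply: (@measurable_state_fun (fun w s => (position q s)%:R)
  _ _ (measurable_after kn)) => l L mL; have [m Lm] := measurable_seq_size mL.
rewrite /position /on_order /= (_ : (fun _ => _) = cst ((l + q * m)%N%:R))//.
by apply/funext => w; rewrite Lm.
Qed.

End MeasurableStates.

(** * Averages along a trajectory *)

Section PathAverages.
Variables (R : realType) (r q : nat) (lam tau : R).
Hypotheses (hq : (0 < q)%N) (lam0 : 0 < lam) (tau0 : 0 < tau).
Variables (s0 : state R) (x : nat -> R).
Hypotheses (s0P : admissible r q tau s0) (x0 : forall i, 0 < x i).

Notation after k := (after_arrivals r q tau s0 x k).
Notation clock := (clock x).
Notation wait := (wait r q tau s0).

Definition in_stock_time n : R := \sum_(k < n) Num.max 0 (x k - wait x k).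

Definition stockout_ratio n : R := (clock n - in_stock_time n) / clock n.

Definition path_average (f : state R -> R) (v : R) : Prop :=
  (\int[lebesgue_measure]_(t in `[0, T]) f (state_at r q tau s0 x t)) / T
    @[T --> +oo] --> v.

Hypothesis arrivals_cvg :
  compensated lam (fun _ _ => 1) (fun _ _ => 0) (4 ^ k) x / (4 ^ k)%:R
    @[k --> \oo] --> (0 : R).

Let T k := clock (4 ^ k).

Lemma clock_gt0 n : (0 < n)%N -> 0 < clock n.
Proof. by move=> n0; rewrite -(clock0 x); exact: clock_lt. Qed.

Let T0 k : 0 < T k.
Proof. by apply: clock_gt0; rewrite expn_gt0. Qed.

(** With unit weights and zero thresholds the compensated sum is [n - lam * clock n], so this is the
    law of large numbers for arrivals along [n = 4 ^ k]. *)
Lemma arrival_rate_cvg : (4 ^ k)%:R / T k @[k --> \oo] --> lam.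
Proof.
have n0 k : (4 ^ k)%:R != 0 :> R by rewrite pnatr_eq0 expn_eq0.
have cE k : compensated lam (fun _ _ => 1) (fun _ _ => 0) (4 ^ k) x =
    (4 ^ k)%:R - lam * T k.
  rewrite /compensated; under eq_bigr => i _.
    rewrite mul1r subr0 (ltW (x0 i)) max_r ?(ltW (x0 i))//; over.
  by rewrite sumrB -mulr_sumr sumr_const card_ord.
have TE k : (4 ^ k)%:R / T k = ((1 - compensated lam (fun _ _ => 1)
    (fun _ _ => 0) (4 ^ k) x / (4 ^ k)%:R) / lam)^-1.
  rewrite cE (_ : 1 - _ = lam * T k / (4 ^ k)%:R); last by field.
  by field; rewrite n0 !lt0r_neq0.
rewrite (funext TE).
rewrite -[X in _ --> X]invrK; apply: cvgV; first by rewrite invr_neq0// lt0r_neq0.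
rewrite -[X in _ --> X]mul1r -[X in X / lam](subr0 1).
by apply: cvgMl; apply: cvgB => //; exact: cvg_cst.
Qed.

Lemma clock_cvg_pinfty : T k @[k --> \oo] --> +oo.
Proof.
apply/cvgryPge => A.
near=> k; have nk : (4 ^ k)%:R / T k < lam + 1.
  by near: k; apply: (cvgr_lt lam arrival_rate_cvg); rewrite ltrDl.
have lam1 : 0 < lam + 1 by rewrite addr_gt0.
rewrite -(ler_pM2l lam1).
move: nk; rewrite ltr_pdivrMr// => /ltW; apply: le_trans.
apply: (@le_trans _ _ k%:R); first by near: k; exact: nbhs_infty_ger.
by rewrite ler_nat ltnW// ltn_expl.
Unshelve. all: end_near. Qed.

(** Disposes of the boundary terms of telescoping sums and of the discrepancy between coupled
    systems. *)
Lemma bounded_div_clock_cvg0 (b : nat -> R) (C : R) :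
  (\forall n \near \oo, `|b n| <= C) ->
  b (4 ^ k)%N / T k @[k --> \oo] --> (0 : R).
Proof.
move=> bC; have CT : C / T k @[k --> \oo] --> (0 : R).
  rewrite -(mulr0 C); apply: cvgMr; apply/gtr0_cvgV0; first exact: nearW.
  exact: clock_cvg_pinfty.
apply/norm_cvg0P; apply: squeeze_cvgr (cvg_cst 0) CT.
case: bC => N _ bC; near=> k; rewrite normr_ge0/= normrM normfV (gtr0_norm (T0 k)).
rewrite ler_wpM2r// ?invr_ge0 ?(ltW (T0 k))//; apply: bC => /=.
apply: leq_trans (ltnW (ltn_expl k _)) => //; near: k.
exact: nbhs_infty_ge.
Unshelve. all: end_near. Qed.

(** The average exists as [T] tends to infinity, so it can be read off along the arrival epochs
    [clock (4 ^ k)], where the integral is a finite sum. *)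
Lemma path_average_clock (f : state R -> R) (v : R) (w : nat -> R) :
  path_average f v ->
  (forall k, has_integral (fun t => f (deliver q t (after k)))
    (clock k) (clock k.+1) (w k)) ->
  (\sum_(i < (4 ^ k)%N) w i) / T k @[k --> \oo] --> v.
Proof.
move=> fv fw; have := cvg_comp _ _ clock_cvg_pinfty fv.
apply: cvg_trans; apply: near_eq_cvg; apply: nearW => k.
by rewrite /= (has_integral_Rintegral (has_integral_state x0 _ fw)).
Qed.

Hypothesis served_cvg :
  compensated lam (fun _ _ => 1) (fun k x => wait x k) (4 ^ k) x / (4 ^ k)%:R
    @[k --> \oo] --> (0 : R).
Hypothesis position_cvg :
  compensated lam (fun k x => (position q (after_arrivals r q tau s0 x k))%:R)
    (fun k x => wait x k) (4 ^ k) x / (4 ^ k)%:R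
    @[k --> \oo] --> (0 : R).

Lemma compensated_div_clock (M : nat -> R) :
  M (4 ^ k)%N / (4 ^ k)%:R @[k --> \oo] --> (0 : R) ->
  M (4 ^ k)%N / T k @[k --> \oo] --> (0 : R).
Proof.
move=> M0; rewrite -(mul0r lam).
have -> : (fun k => M (4 ^ k)%N / T k) =
    fun k => M (4 ^ k)%N / (4 ^ k)%:R * ((4 ^ k)%:R / T k).
  apply/funext => k; field.
  by rewrite lt0r_neq0//= pnatr_eq0 expn_eq0.
by apply: cvgM => //; exact: arrival_rate_cvg.
Qed.

Section Stockout.
Variable gamma : R.
Hypothesis gammaP : path_average (fun s => (on_hand s == 0%N)%:R) gamma.

Lemma stockout_ratio_cvg : stockout_ratio (4 ^ k)%N @[k --> \oo] --> gamma.
Proof.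
have := path_average_clock gammaP (stockout_integral hq tau0 s0P x0).
by under eq_fun do rewrite sumrB.
Qed.

Lemma in_stock_cvg : in_stock_time (4 ^ k)%N / T k @[k --> \oo] --> 1 - gamma.
Proof.
have -> : (fun k => in_stock_time (4 ^ k)%N / T k) =
    fun k => 1 - stockout_ratio (4 ^ k)%N.
  by apply/funext => k; rewrite /stockout_ratio -/(T k); field; exact: lt0r_neq0.
by apply: cvgB; [exact: cvg_cst|exact: stockout_ratio_cvg].
Qed.

(** With thresholds [wait], the compensated sum is the number of served customers minus [lam] times
    the time in stock. *)
Lemma served_rate_cvg :
  served r q tau s0 x (4 ^ k)%N / T k @[k --> \oo] --> lam * (1 - gamma).
Proof.
rewrite -[X in _ --> X]add0r.
have -> : (fun k => served r q tau s0 x (4 ^ k)%N / T k) = fun k =>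
    compensated lam (fun _ _ => 1) (fun k x => wait x k) (4 ^ k) x / T k +
    lam * (in_stock_time (4 ^ k)%N / T k).
  apply/funext => k; rewrite mulrA -mulrDl; congr (_ / _).
  rewrite /served /in_stock_time mulr_sumr -big_split; apply: eq_bigr => i _ /=.
  by rewrite mul1r subrK.
apply: cvgD; first exact: (compensated_div_clock (M := fun n =>
  compensated lam (fun _ _ => 1) (fun k x => wait x k) n x)).
by apply: cvgMr; exact: in_stock_cvg.
Qed.

Let balance n : R :=
  q%:R * residual (clock n) (after n) - tau * (position q (after n))%:R.

(** Each residual lies in [[0, tau]] and [q] times the number of orders is at most the position, so
    both terms of [balance] lie between [0] and [tau * (r + q)]. *)
Let balance_bound n : `|balance n| <= tau * (r + q)%:R.
Proof.
have /andP[_ prq] := in_range_after hq tau0 x s0P n.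
have due_n e : e \in due (after n) -> 0 <= e - clock n <= tau.
  move=> /(due_after tau0 s0P x0)/andP[/ltW ne en].
  by rewrite subr_ge0 ne lerBlDl.
have res0 : 0 <= residual (clock n) (after n).
  by rewrite /residual big_seq sumr_ge0// => e /due_n/andP[].
have resT : residual (clock n) (after n) <= (size (due (after n)))%:R * tau.
  rewrite /residual -sum1_size natr_sum mulr_suml !big_seq ler_sum// => e.
  by rewrite mul1r => /due_n/andP[].
have qres : q%:R * residual (clock n) (after n) <= tau * (position q (after n))%:R.
  rewrite (le_trans (ler_wpM2l _ resT))// mulrA -natrM [leRHS]mulrC ler_wpM2r//.
    exact: ltW.
  by rewrite ler_nat leq_addl.
have pos : tau * (position q (after n))%:R <= tau * (r + q)%:R.
  by rewrite ler_wpM2l ?(ltW tau0)// ler_nat.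
have qres0 : 0 <= q%:R * residual (clock n) (after n) by rewrite mulr_ge0.
have pos0 : 0 <= tau * (position q (after n))%:R by rewrite mulr_ge0// ltW.
by rewrite ler_norml /balance; apply/andP; split; lra.
Qed.

Lemma on_order_averageE (U : R) :
  path_average (fun s => (on_order q s)%:R) U -> U = (1 - gamma) * (lam * tau).
Proof.
move=> /path_average_clock/(_ (on_order_integral tau0 s0P x0)) IU.
pose I n : R := balance 0 - balance n + tau * served r q tau s0 x n.
have sumE n : \sum_(k < n) q%:R *
    \sum_(e <- due (after k)) (Num.min e (clock k.+1) - clock k) = I n.
  rewrite /I; elim: n => [|n IHn].
    by rewrite /served !big_ord0 subrr mulr0 addr0.
  rewrite big_ord_recr/= IHn /served big_ord_recr/=.
  by rewrite (on_order_balance hq tau0 s0P x0) /balance; ring.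
rewrite (funext (fun k => congr1 (fun z => z / T k) (sumE (4 ^ k)%N))) in IU.
apply/esym/(cvg_unique (@Rhausdorff R) _ IU).
have -> : (fun k => I (4 ^ k)%N / T k) = fun k =>
    (balance 0 - balance (4 ^ k)%N) / T k +
    tau * (served r q tau s0 x (4 ^ k)%N / T k).
  by apply/funext => k; rewrite /I mulrDl mulrA.
rewrite (_ : (1 - gamma) * _ = 0 + tau * (lam * (1 - gamma))); last by ring.
apply: cvgD; last by apply: cvgMr; exact: served_rate_cvg.
apply: (@bounded_div_clock_cvg0 (fun n => balance 0 - balance n)
  (tau * (r + q)%:R + tau * (r + q)%:R)).
by apply: nearW => n; rewrite (le_trans (ler_normB _ _))// lerD.
Qed.

Let potential_bound n :
  `|position_potential R r q (position q (after n))| <= 2 * (r + q)%:R ^+ 2.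
Proof.
have /andP[_ prq] := in_range_after hq tau0 x s0P n.
have {}prq : (position q (after n))%:R <= r%:R + q%:R :> R.
  by rewrite -natrD ler_nat.
rewrite /position_potential natrD.
have := ler0n R (position q (after n)); have := ler0n R r; have := ler0n R q.
move: (_%:R) (r%:R) (q%:R) prq => p a b pab b0 a0 p0.
by rewrite ler_norml; apply/andP; split; nra.
Qed.

Lemma position_averageE (P : R) :
  path_average (fun s => (position q s)%:R) P ->
  P = (1 - gamma) * cycle_mean R r q + gamma * (empty_position r q)%:R.
Proof.
move=> /path_average_clock/(_ (position_integral r q tau s0 x0)) IP.
pose M n : R := compensated lam (fun k x =>
  (position q (after_arrivals r q tau s0 x k))%:R) (fun k x => wait x k) n x.
pose phi n : R := position_potential R r q (position q (after n)).
(* Each [x k] splits into stockout time, spent at [empty_position], and time in stock. The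
   position-weighted time in stock is exchanged through [M] for the sum of positions over served
   customers, which [sum_served_position] evaluates. *)
pose J n : R := lam^-1 * (cycle_mean R r q * served r q tau s0 x n +
  (phi n - phi 0%N) - M n) + (empty_position r q)%:R * (clock n - in_stock_time n).
have sumE n : \sum_(k < n) (position q (after k))%:R * x k = J n.
  rewrite /J addrA -(sum_served_position hq tau0 s0P x0) /M /compensated.
  rewrite -sumrB mulr_sumr /in_stock_time -[clock n]/(\sum_(k < n) x k) -sumrB.
  rewrite mulr_sumr -big_split.
  apply: eq_bigr => k _ /=; rewrite -(position_unavailable hq tau0 s0P x0).
  by field; exact: lt0r_neq0.
rewrite (funext (fun k => congr1 (fun z => z / T k) (sumE (4 ^ k)%N))) in IP.
apply/esym/(cvg_unique (@Rhausdorff R) _ IP).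
have -> : (fun k => J (4 ^ k)%N / T k) = fun k =>
    lam^-1 * (cycle_mean R r q * (served r q tau s0 x (4 ^ k)%N / T k) +
      (phi (4 ^ k)%N - phi 0%N) / T k - M (4 ^ k)%N / T k) +
    (empty_position r q)%:R * stockout_ratio (4 ^ k)%N.
  by apply/funext => k; rewrite /J /stockout_ratio -/(T k); ring.
have -> : (1 - gamma) * cycle_mean R r q + gamma * (empty_position r q)%:R =
    lam^-1 * (cycle_mean R r q * (lam * (1 - gamma)) + 0 - 0) +
    (empty_position r q)%:R * gamma.
  by field; exact: lt0r_neq0.
apply: cvgD; last by apply: cvgMr; exact: stockout_ratio_cvg.
apply: cvgMr; apply: cvgB; last exact: compensated_div_clock.
apply: cvgD; first by apply: cvgMr; exact: served_rate_cvg.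
apply: (@bounded_div_clock_cvg0 (fun n => phi n - phi 0%N)
  (2 * (r + q)%:R ^+ 2 + 2 * (r + q)%:R ^+ 2)).
apply: nearW => n; apply: le_trans (ler_normB _ _) _.
by apply: lerD; exact: potential_bound.
Qed.

End Stockout.

Lemma on_hand_averageE (L P U : R) :
  path_average (fun s => (on_hand s)%:R) L ->
  path_average (fun s => (position q s)%:R) P ->
  path_average (fun s => (on_order q s)%:R) U -> L = P - U.
Proof.
move=> /path_average_clock/(_ (on_hand_integral tau0 s0P x0)) IL.
move=> /path_average_clock/(_ (position_integral r q tau s0 x0)) IP.
move=> /path_average_clock/(_ (on_order_integral tau0 s0P x0)) IU.
apply: (cvg_unique (@Rhausdorff R) IL).
rewrite /=; under eq_fun do rewrite sumrB mulrBl.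
exact: cvgB IP IU.
Qed.

End PathAverages.

(** * Almost sure regularity and conclusion *)

Lemma measurable_inv (R : realType) :
  measurable_fun [set: R] (fun y : R => y^-1).
Proof.
rewrite -(setUv [set (0 : R)]); apply/measurable_funU => //.
  exact: measurableC.
split.
  apply: (@eq_measurable_fun _ _ _ _ _ (cst (0 : R))) => //.
  by move=> y /[!inE] ->; rewrite invr0.
apply: open_continuous_measurable_fun.
  exact/closed_openC/closed_eq.
by move=> y /[!inE]/= /eqP y0; exact: inv_continuous.
Qed.

Section AlmostSure.
Variables (R : realType) (d : measure_display) (Omega : measurableType d).
Variables (Pr : probability Omega R).

Lemma ae_exists (Q : Omega -> Prop) : {ae Pr, forall w, Q w} -> exists w, Q w.
Proof.
move=> aeQ; apply: contrapT => /forallNP nQ.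
have [A [mA A0 QA]] := aeQ.
have : Pr setT = 0%E.
  apply/eqP; rewrite -measure_le0 -A0; apply: le_measure; rewrite ?inE//.
  by move=> w _; apply: QA => /=; exact: nQ.
by rewrite probability_setT => /eqP; rewrite eqe oner_eq0.
Qed.

Lemma measurable_cvg_set d' (T : measurableType d') (f : nat -> T -> R) (l : R) :
  (forall k, measurable_fun setT (f k)) ->
  measurable [set w | f k w @[k --> \oo] --> l].
Proof.
move=> mf; rewrite (_ : [set w | _] = \bigcap_j \bigcup_N \bigcap_k
    [set w | (N <= k)%N -> `|l - f k w| < j.+1%:R^-1]).
  apply: bigcapT_measurable => j; apply: bigcupT_measurable => N.
  apply: bigcapT_measurable => k; have [Nk|kN] := leqP N k; last first.
    by rewrite [X in measurable X](_ : _ = setT)//; apply/seteqP; split.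
  have mfk : measurable_fun setT (fun w => `|l - f k w|).
    by apply: measurableT_comp => //; exact: measurable_funB.
  rewrite [X in measurable X](_ : _ =
      (fun w => `|l - f k w|) @^-1` `]-oo, (j.+1%:R^-1)[).
    by rewrite -[X in measurable X]setTI; apply: mfk => //; exact: measurable_itv.
  by apply/seteqP; split=> w /=; rewrite in_itv/=; [apply|move=> h _].
apply/seteqP; split=> w /=.
  move=> /cvgrPdist_lt fl j _; have j0 : 0 < j.+1%:R^-1 :> R by rewrite invr_gt0.
  by have [N _ NP] := fl _ j0; exists N => // k _ Nk; exact: NP.
move=> fl; apply/cvgrPdist_lt => e e0.
have [j _ /(_ j (leqnn j)) je] := near_infty_natSinv_lt (PosNum e0).
have [N _ NP] := fl j I; exists N => // k Nk.
by apply: lt_trans je; exact: NP.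
Qed.

Variables (X : nat -> {RV Pr >-> R}) (lam : R).
Hypothesis XP : poisson_interarrivals lam X.

Lemma interarrival_gt0 : {ae Pr, forall w, forall i, 0 < sample_path X w i}.
Proof.
apply: ae_foralln => i.
exists (X i @^-1` `]-oo, 0]); split.
- rewrite -[X in measurable X]setTI.
  by apply: measurable_funP => //; exact: measurable_itv.
- transitivity (distribution Pr (X i) `]-oo, 0]); first by [].
  rewrite (proj2 XP); last exact: measurable_itv.
  rewrite /exponential_prob -integral_itv_bndo_bndc.
    apply: integral0_eq => y /=; rewrite in_itv/= => y0.
    by rewrite lt0_exponential_pdf.
  apply/measurable_EFinP; apply: measurable_funTS.
  exact: measurable_exponential_pdf.
- by move=> w /= /negP; rewrite -leNgt in_itv.
Qed.

End AlmostSure.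

(** * Uniqueness of the stockout fraction *)

Section Regularity.
Variables (R : realType) (r q : nat) (lam tau : R).
Hypotheses (hq : (0 < q)%N) (lam0 : 0 < lam) (tau0 : 0 < tau).

Definition compensated_mean_cvg0 (g u : nat -> (nat -> R) -> R) (x : nat -> R) :=
  compensated lam g u (4 ^ k) x / (4 ^ k)%:R @[k --> \oo] --> (0 : R).

Definition regular_path (s0 : state R) (x : nat -> R) : Prop :=
  [/\ forall i, 0 < x i,
      compensated_mean_cvg0 (fun _ _ => 1) (fun _ _ => 0) x,
      compensated_mean_cvg0 (fun _ _ => 1) (fun k x => wait r q tau s0 x k) x &
      compensated_mean_cvg0
        (fun k x => (position q (after_arrivals r q tau s0 x k))%:R)
        (fun k x => wait r q tau s0 x k) x].

Section Almost.
Variables (d : measure_display) (Omega : measurableType d).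
Variables (Pr : probability Omega R) (X : nat -> {RV Pr >-> R}).
Hypothesis XP : poisson_interarrivals lam X.

Lemma regular_path_ae (s0 : state R) : admissible r q tau s0 ->
  {ae Pr, forall w, regular_path s0 (sample_path X w)}.
Proof.
move=> s0P.
have mcoord n i : (i < n)%N ->
    measurable_fun setT ((fun v : past R n => (v : nat -> R)) ^~ i).
  exact: measurable_coord.
have mw n : measurable_fun [set: past R n]
    ((fun x => wait r q tau s0 x n) : past R n -> R).
  exact: (@measurable_wait _ _ (past R n) r q tau s0
    (fun v : past R n => (v : nat -> R)) n (mcoord n) n (leqnn n)).
have mp n : measurable_fun [set: past R n]
    ((fun x => (position q (after_arrivals r q tau s0 x n))%:R) : past R n -> R).
  exact: (@measurable_position _ _ (past R n) r q tau s0
    (fun v : past R n => (v : nat -> R)) n (mcoord n) n (leqnn n)).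
have w0 n x : 0 <= wait r q tau s0 x n by rewrite le_max lexx.
have c1 : {ae Pr, forall w,
    compensated_mean_cvg0 (fun _ _ => 1) (fun _ _ => 0) (sample_path X w)}.
  by apply: (compensated_cvg lam0 XP (K := 1)) => // n x; rewrite normr1.
have c2 : {ae Pr, forall w, compensated_mean_cvg0 (fun _ _ => 1)
    (fun k x => wait r q tau s0 x k) (sample_path X w)}.
  by apply: (compensated_cvg lam0 XP (K := 1)) => // n x; rewrite normr1.
have c3 : {ae Pr, forall w, compensated_mean_cvg0
    (fun k x => (position q (after_arrivals r q tau s0 x k))%:R)
    (fun k x => wait r q tau s0 x k) (sample_path X w)}.
  apply: (compensated_cvg lam0 XP (K := (r + q)%:R)) => // n x.
  by rewrite normr_nat ler_nat; have /andP[] := in_range_after hq tau0 x s0P n.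
have c0 := interarrival_gt0 XP.
by apply: filterS (filterI (filterI c0 c1) (filterI c2 c3)) => w [[? ?] [? ?]].
Qed.

End Almost.

(** Once the pattern is complete, the two systems accumulate time in stock equally, so the
    difference [b] stays at its value [b N]. *)
Lemma stockout_ratio_coupled (s s' : state R) (x : nat -> R) n (gamma : R) :
  admissible r q tau s -> admissible r q tau s' ->
  regular_path s x -> pattern_at (forgetting_gap r q tau) n (r + q).+1 x ->
  stockout_ratio r q tau s x (4 ^ k)%N @[k --> \oo] --> gamma ->
  stockout_ratio r q tau s' x (4 ^ k)%N @[k --> \oo] --> gamma.
Proof.
move=> sP s'P [x0 c1 _ _] xn sg; rewrite -[gamma]addr0.
pose b k := in_stock_time r q tau s x k - in_stock_time r q tau s' x k.
have -> : (fun k => stockout_ratio r q tau s' x (4 ^ k)%N) = fun k =>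
    stockout_ratio r q tau s x (4 ^ k)%N + b (4 ^ k)%N / clock x (4 ^ k).
  by apply/funext => k; rewrite /stockout_ratio /b -mulrDl; congr (_ / _); ring.
apply: cvgD => //.
pose N := (n + (r + q).+1)%N.
apply: (bounded_div_clock_cvg0 lam0 x0 c1 (C := `|b N|)).
exists N => // k /= Nk; rewrite (_ : b k = b N)//.
rewrite -(subnK Nk); elim: (k - N)%N => [|i IHi]; first by rewrite add0n.
rewrite addSn -IHi /b /in_stock_time !big_ord_recr /= {2 4}/wait.
by rewrite (after_coupled hq tau0 sP s'P x0 xn) ?leq_addl//; ring.
Qed.

Lemma stockout_fraction_unique (S S' : lost_sales_system r q lam tau)
    (gamma gamma' : R) :
  stockout_fraction S gamma -> stockout_fraction S' gamma' -> gamma = gamma'.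
Proof.
move=> Sg Sg'.
pose s := initial S; pose s' := initial S'.
have sP : admissible r q tau s := initialP S.
have s'P : admissible r q tau s' := initialP S'.
(* The dynamics started from [s'], the limit [gamma] of the system started from [s]. Each ratio
   depends on finitely many coordinates, so [E] is measurable on path space. *)
pose E : set (path_space R) :=
  [set x | stockout_ratio r q tau s' x (4 ^ k)%N @[k --> \oo] --> gamma].
have mE : measurable E.
  apply: measurable_cvg_set => k.
  have mx i : (i < 4 ^ k)%N ->
      measurable_fun setT ((fun x : path_space R => (x : nat -> R)) ^~ i).
    by move=> _; exact: measurable_path_coord.
  have mclock := @measurable_clock _ _ (path_space R) _ _ mx _ (leqnn _).
  have mstock : measurable_fun setT (fun x : path_space R =>
      in_stock_time r q tau s' (x : nat -> R) (4 ^ k)%N).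
    apply: measurable_sum => i; apply: measurable_maxr => //.
    apply: measurable_funB; first exact: measurable_path_coord.
    exact: (@measurable_wait _ _ (path_space R) r q tau s' _ _ mx i
      (ltnW (ltn_ord i))).
  apply: measurable_funM; first exact: measurable_funB.
  exact: measurableT_comp (@measurable_inv R) mclock.
have Ereg w : regular_path s (sample_path (interarrival S) w) ->
    stockout_ratio r q tau s (sample_path (interarrival S) w) (4 ^ k)%N
      @[k --> \oo] --> gamma ->
    (exists b, pattern_at (forgetting_gap r q tau) (b * (r + q).+1) (r + q).+1
      (sample_path (interarrival S) w)) -> E (sample_path (interarrival S) w).
  by move=> wreg wg [b wb]; exact: stockout_ratio_coupled wreg wb wg.
have SE : {ae prob S, forall w, E (sample_path (interarrival S) w)}.
  have ae1 := regular_path_ae (interarrivalP S) sP.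
  have ae2 := pattern_almost_surely (interarrivalP S) (r + q).+1
    (@measurable_forgetting_gap R r q tau)
    (fun i => forgetting_gap_gt0 r hq tau0 i lam0).
  apply: filterS (filterI (filterI ae1 Sg) ae2) => w [[w1 w2] w3].
  apply: Ereg => //; have [w0 c1 _ _] := w1.
  exact: (stockout_ratio_cvg hq lam0 tau0 sP w0 c1 w2).
have mCE : measurable (~` E : set (path_space R)) by exact: measurableC.
(* Coupling gave [E] almost surely for the interarrival times of [S]; equality of laws carries it to
   those of [S'], where the ratio also tends to [gamma']. *)
have S'E : {ae prob S', forall w, E (sample_path (interarrival S') w)}.
  exists (sample_path (interarrival S') @^-1` (~` E)); split=> //.
    rewrite -[X in measurable X]setTI.
    by apply: (@measurable_full_path _ _ _ _ (interarrival S')).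
  rewrite -(distribution_path_unique (interarrivalP S) (interarrivalP S') mCE).
  have [A [mA A0 EA]] := SE; apply/eqP; rewrite -measure_le0 -A0.
  apply: le_measure; rewrite ?inE//.
  rewrite -[X in measurable X]setTI.
  by apply: (@measurable_full_path _ _ _ _ (interarrival S)).
have ae1 := regular_path_ae (interarrivalP S') s'P.
have [w [[[w0 c1 _ _] w2] w3]] := ae_exists (filterI (filterI ae1 Sg') S'E).
apply: (cvg_unique (@Rhausdorff R) w3).
exact: (stockout_ratio_cvg hq lam0 tau0 s'P w0 c1 w2).
Qed.

End Regularity.

Theorem theorem1 (R : realType) (r q : nat) (lam tau : R)
    (hq : (1 <= q)%N) (hlam : 0 < lam) (htau : 0 < tau)
    (S : lost_sales_system r q lam tau) (gamma L P U : R)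
    (hS : long_run_averages S gamma L P U) :
  let x := lam * tau in
  [/\ P = (1 - gamma) * (r%:R + (q%:R + 1) / 2)
            + gamma * (q%:R * ((r + q) %/ q)%N%:R),
      L = P - U,
      U = (1 - gamma) * x,
      L = (1 - gamma) * (r%:R + (q%:R + 1) / 2 - x)
            + gamma * (q%:R * ((r + q) %/ q)%N%:R) &
      forall (S' : lost_sales_system r q lam tau) (gamma' L' P' U' : R),
        long_run_averages S' gamma' L' P' U' ->
        [\/ gamma = gamma', L = L', P = P' | U = U'] ->
        [/\ gamma = gamma', L = L', P = P' & U = U']].
Proof.
have averagesE (S1 : lost_sales_system r q lam tau) (gamma1 L1 P1 U1 : R) :
    long_run_averages S1 gamma1 L1 P1 U1 ->
    [/\ P1 = (1 - gamma1) * (r%:R + (q%:R + 1) / 2)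
            + gamma1 * (q%:R * ((r + q) %/ q)%N%:R),
        L1 = P1 - U1 & U1 = (1 - gamma1) * (lam * tau)].
  move=> [Sg SL SP SU].
  have S1P := initialP S1.
  have reg := regular_path_ae hq hlam htau (interarrivalP S1) S1P.
  (* The averages are constants, so the relations need only be checked on a single sample path
     satisfying all the almost sure properties. *)
  have [w [[[w0 c1 c2 c3] wg] [wL [wP wU]]]] :=
    ae_exists (filterI (filterI reg Sg) (filterI SL (filterI SP SU))).
  split.
  - rewrite -natrM.
    exact: (position_averageE hq hlam htau S1P w0 c1 c2 c3 wg wP).
  - exact: (on_hand_averageE hlam htau S1P w0 c1 wL wP wU).
  - exact: (on_order_averageE hq hlam htau S1P w0 c1 c2 wg wU).
move=> x; have [PE LE UE] := averagesE S gamma L P U hS.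
split=> //; first by rewrite LE PE UE /x; ring.
move=> S' gamma' L' P' U' hS' _.
have [PE' LE' UE'] := averagesE S' gamma' L' P' U' hS'.
have gg' : gamma = gamma'.
  by apply: (stockout_fraction_unique hq hlam htau (S := S) (S' := S'));
    [case: hS|case: hS'].
by rewrite LE LE' PE PE' UE UE' gg'.
Qed.
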